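(* For all integers $m\ge0$ and $n\ge1$, the Hilbert series $\sum_{d\ge0}\dim_{\mathbb F_q}\bigl(\mathcal Q_m(n)^{\mathrm B_n}\bigr)_d\,t^d$ of the graded $\mathbb F_q$-vector space of $\mathrm B_n$-invariants of $\mathcal Q_m(n)$ equals $$\sum_{\beta\in\{0,1\}^n,\ |\beta|\le m} t^{e(m,1^n,\beta)}\begin{bmatrix} m\\ \beta,\,m-|\beta|\end{bmatrix}_{q,t},\qquad e(m,1^n,\beta)=\sum_{i=1}^n(1-\beta_i)(q^m-q^{B_i}),$$ where for $\beta=(\beta_1,\ldots,\beta_n)$ we write $B_i=\beta_1+\cdots+\beta_i$ and $|\beta|=\beta_1+\cdots+\beta_n$.
   Context: Let $q$ be a power of a prime and $\mathbb F_q$ the field with $q$ elements. $\mathrm{GL}_n(\mathbb F_q)$ acts on $\mathbb F_q[x_1,\ldots,x_n]$ (each $x_i$ in degree $1$) by $\sigma f(x_1,\ldots,x_n)=f(\sigma x_1,\ldots,\sigma x_n)$, where $\sigma x_j=\sum_{i=1}^n\sigma_{ij}x_i$. This induces an action on the graded ring $\mathcal Q_m(n)=\mathbb F_q[x_1,\ldots,x_n]/(x_1^{q^m},\ldots,x_n^{q^m})$. $\mathrm B_n\subset\mathrm{GL}_n(\mathbb F_q)$ is the Borel subgroup of invertible upper triangular matrices. For a weak composition $\alpha=(\alpha_1,\ldots,\alpha_\ell)$ of $k$ (non-negative integers with sum $k$) with partial sums $A_i=\alpha_1+\cdots+\alpha_i$, the $(q,t)$-multinomial coefficient is $$\begin{bmatrix}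 k\\ \alpha\end{bmatrix}_{q,t}=\frac{\prod_{j=0}^{k-1}(1-t^{q^k-q^j})}{\prod_{i=1}^{\ell}\prod_{j=1}^{\alpha_i}(1-t^{q^{A_i}-q^{A_i-j}})}.$$ Here it is applied to the weak composition $(\beta_1,\ldots,\beta_n,m-|\beta|)$ of $m$. *)

(* Defs.v *)
From HB Require Import structures.
From mathcomp Require Import all_boot all_order all_algebra.
From mathcomp Require Import abelian finfield.
From mathcomp Require Import boolp.
From mathcomp Require Import freeg mpoly.

Set Implicit Arguments.
Unset Strict Implicit.
Unset Printing Implicit Defensive.

Import GRing.Theory.
Local Open Scope ring_scope.
Local Open Scope quotient_scope.

Section TruncatedPolynomials.

Variables (F : finFieldType) (m n : nat).

Local Notation q := #|F|.

Definition frob_ideal (p : {mpoly F[n]}) : bool :=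
  `[< exists h : 'I_n -> {mpoly F[n]}, p = \sum_i h i * 'X_i ^+ (q ^ m) >].

Lemma frob_idealP (p : {mpoly F[n]}) :
  reflect (exists h : 'I_n -> {mpoly F[n]},
             p = \sum_i h i * 'X_i ^+ (q ^ m)) (p \in frob_ideal).
Proof. exact: asboolP. Qed.

Lemma qm_gt0 : (0 < q ^ m)%N.
Proof. by rewrite expn_gt0 (ltnW (card_finNzRing_gt1 F)). Qed.

Fact frob_ideal_closed : idealr_closed frob_ideal.
Proof.
split.
- apply/frob_idealP; exists (fun=> 0).
  by rewrite big1 // => i _; rewrite mul0r.
- apply/negP => /frob_idealP [h /(congr1 (meval (fun=> 0)))].
  rewrite meval1 raddf_sum big1 => [/eqP|i _]; first by rewrite oner_eq0.
  by rewrite /= mevalM rmorphXn /= mevalXU expr0n gtn_eqF ?qm_gt0 // mulr0.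
move=> a u v /frob_idealP [h ->] /frob_idealP [k ->].
apply/frob_idealP; exists (fun i => a * h i + k i).
rewrite mulr_sumr -big_split /=; apply: eq_bigr => i _.
by rewrite mulrDl mulrA.
Qed.

Definition frob_idealr : idealr {mpoly F[n]} :=
  HB.pack_for (idealr {mpoly F[n]}) frob_ideal
    (isIdealr.Build {mpoly F[n]} frob_ideal frob_ideal_closed).

Definition trunc_poly : Type := {ideal_quot frob_idealr}.

HB.instance Definition _ := GRing.ComNzRing.on trunc_poly.

Definition tpi (p : {mpoly F[n]}) : trunc_poly :=
  \pi_{ideal_quot frob_idealr} p.

HB.instance Definition _ := GRing.RMorphism.copy tpi
  (\pi_{ideal_quot frob_idealr} : {mpoly F[n]} -> {ideal_quot frob_idealr}).

Definition trepr (u : trunc_poly) : {mpoly F[n]} :=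
  repr (u : {ideal_quot frob_idealr}).

Lemma treprK u : tpi (trepr u) = u.
Proof. exact: reprK. Qed.

Lemma tpi_eq p1 p2 : (tpi p1 == tpi p2) = (p1 - p2 \in frob_ideal).
Proof. by rewrite (Quotient.idealrBE frob_idealr). Qed.

Lemma tpi_eq0 p : (tpi p == 0) = (p \in frob_ideal).
Proof. by rewrite -(rmorph0 tpi) tpi_eq subr0. Qed.

Definition tscale (a : F) (u : trunc_poly) : trunc_poly := tpi a%:MP * u.

Fact tscaleA a b u : tscale a (tscale b u) = tscale (a * b) u.
Proof. by rewrite /tscale mulrA mpolyCM rmorphM. Qed.
Fact tscale1 : left_id 1 tscale.
Proof. by move=> u; rewrite /tscale mpolyC1 rmorph1 mul1r. Qed.
Fact tscaleDr : right_distributive tscale +%R.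
Proof. by move=> a u v; rewrite /tscale mulrDr. Qed.
Fact tscaleDl u : {morph tscale^~ u : a b / a + b}.
Proof. by move=> a b; rewrite /tscale mpolyCD rmorphD mulrDl. Qed.

HB.instance Definition _ := GRing.Zmodule_isLmodule.Build F trunc_poly
  tscaleA tscale1 tscaleDr tscaleDl.

Fact tpi_is_scalable : scalable tpi.
Proof. by move=> a p; rewrite -mul_mpolyC rmorphM. Qed.
HB.instance Definition _ :=
  GRing.isScalable.Build F {mpoly F[n]} trunc_poly _ tpi tpi_is_scalable.

Lemma frob_ideal_monomial (k : 'X_{1..n}) :
  (exists i, q ^ m <= k i)%N -> 'X_[k] \in frob_ideal.
Proof.
case=> i lek; apply/frob_idealP.
exists (fun j => if j == i then 'X_[(k - U_(i) *+ (q ^ m))%MM] else 0).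
rewrite (bigD1 i) //= eqxx big1 ?addr0 => [|j /negPf->]; last by rewrite mul0r.
rewrite mpolyXn -mpolyXD submK //; apply/mnm_lepP => j.
by rewrite mulmnE mnm1E; case: eqP => [<-|_]; rewrite ?mul1n ?mul0n.
Qed.

Lemma frob_ideal_coef p (k : 'X_{1..n}) :
  p \in frob_ideal -> (forall i, k i < q ^ m)%N -> p@_k = 0.
Proof.
case/frob_idealP => h -> ltk; rewrite raddf_sum big1 // => i _ /=.
rewrite mpolyXn; apply: memN_msupp_eq0; rewrite (perm_mem (msuppMX _ _)).
apply/mapP => -[k' _ ek].
by have := ltk i; rewrite ek mnmDE mulmnE mnm1E eqxx mul1n ltnNge leq_addr.
Qed.

Lemma frob_idealPcoef p :
  reflect (forall k : 'X_{1..n}, (forall i, k i < q ^ m)%N -> p@_k = 0)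
          (p \in frob_ideal).
Proof.
apply: (iffP idP) => [Ip k|p0]; first exact: frob_ideal_coef.
rewrite -tpi_eq0 [p]mpolyE raddf_sum big1 // => k _ /=.
have [/forallP/p0 ->|] := boolP [forall i, k i < q ^ m]%N.
  by rewrite scale0r raddf0.
rewrite negb_forall => /existsP[i]; rewrite -leqNgt => lek; rewrite linearZ /=.
have /eqP -> : tpi 'X_[k] == 0.
  by rewrite tpi_eq0; apply: frob_ideal_monomial; exists i.
by rewrite scaler0.
Qed.

Local Notation bounded_exp := {ffun 'I_n -> 'I_(q ^ m)}.

Definition bounded_mnm (f : bounded_exp) : 'X_{1..n} :=
  [multinom (f i : nat) | i < n].

Definition tcoord (u : trunc_poly) : 'rV[F]_#|{: bounded_exp}| :=
  \row_k (trepr u)@_(bounded_mnm (enum_val k)).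

Lemma bounded_mnm_lt f i : (bounded_mnm f i < q ^ m)%N.
Proof. by rewrite mnmE. Qed.

Lemma bounded_mnm_inj : injective bounded_mnm.
Proof.
move=> f g /mnmP efg; apply/ffunP => i; apply/val_inj.
by have := efg i; rewrite !mnmE.
Qed.

Lemma tcoordE p k : tcoord (tpi p) 0 k = p@_(bounded_mnm (enum_val k)).
Proof.
rewrite mxE; apply/eqP; rewrite -subr_eq0 -mcoeffB; apply/eqP.
by apply: frob_ideal_coef => [|i]; rewrite ?bounded_mnm_lt // -tpi_eq treprK.
Qed.

Fact trunc_poly_vect_axiom : Vector.axiom #|{: bounded_exp}| trunc_poly.
Proof.
exists tcoord.
  move=> a u v; apply/rowP => k; rewrite -[u]treprK -[v]treprK.
  by rewrite -linearP /= tcoordE !mxE -!/(tcoord _ 0 k) mcoeffD mcoeffZ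
     -!tcoordE !mxE !treprK.
exists (fun r : 'rV[F]_#|{: bounded_exp}| =>
          tpi (\sum_k r 0 k *: 'X_[bounded_mnm (enum_val k)])).
  move=> u; apply/eqP; rewrite -[X in _ == X]treprK tpi_eq.
  apply/frob_idealPcoef => k ltk.
  pose f : bounded_exp := [ffun i => Ordinal (ltk i)].
  have -> : k = bounded_mnm f by apply/mnmP => i; rewrite mnmE ffunE.
  rewrite mcoeffB raddf_sum (bigD1 (enum_rank f)) //= enum_rankK.
  rewrite mcoeffZ mcoeffX eqxx mulr1 mxE enum_rankK big1 ?addr0 ?subrr //.
  move=> l nlf; rewrite mcoeffZ mcoeffX (inj_eq bounded_mnm_inj).
  by rewrite -(inj_eq enum_rank_inj) enum_valK (negPf nlf) mulr0.
move=> r; apply/rowP => k; rewrite tcoordE raddf_sum (bigD1 k) //=.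
rewrite mcoeffZ mcoeffX eqxx mulr1 big1 ?addr0 // => l nlk.
rewrite mcoeffZ mcoeffX (inj_eq bounded_mnm_inj) (inj_eq enum_val_inj).
by rewrite (negPf nlk) mulr0.
Qed.

HB.instance Definition _ :=
  Lmodule_hasFinDim.Build F trunc_poly trunc_poly_vect_axiom.

(* Substitution of [\sum_i s i j *: 'X_i] for ['X_j]; the induced map on the
   quotient is well defined by [trunc_act_pi]. *)
Definition gl_subst (s : 'M[F]_n) (p : {mpoly F[n]}) : {mpoly F[n]} :=
  p \mPo [tuple \sum_i s i j *: 'X_i | j < n].

Definition trunc_act (s : 'M[F]_n) (u : trunc_poly) : trunc_poly :=
  tpi (gl_subst s (trepr u)).

Lemma frobenius_sum (I : Type) (r : seq I) (P : pred I)
    (f : I -> {mpoly F[n]}) :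
  (\sum_(i <- r | P i) f i) ^+ (q ^ m) = \sum_(i <- r | P i) f i ^+ (q ^ m).
Proof.
have [p pr_p pcharF] := finPcharP F.
have pM : p \in [pchar {mpoly F[n]}].
  rewrite inE pr_p /= -mpolyC_nat mpolyC_eq0; exact/eqP/pcharf0.
have qnat : [pchar {mpoly F[n]}].-nat (q ^ m)%N.
  rewrite (eq_pnat _ (pcharf_eq pM)) pnatX -cardsT.
  by have := abelem_pgroup (fin_ring_pchar_abelem pcharF);
     rewrite /pgroup.pgroup => ->.
elim/big_rec2: _ => [|i x y _ <-]; last by rewrite exprDn_pchar.
by rewrite expr0n gtn_eqF ?qm_gt0.
Qed.

Lemma gl_subst_ideal s p : p \in frob_ideal -> gl_subst s p \in frob_ideal.
Proof.
case/frob_idealP => h ->; rewrite /gl_subst raddf_sum.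
rewrite -tpi_eq0 raddf_sum big1 // => j _ /=.
rewrite rmorphM rmorphXn /= comp_mpolyXU -tnth_nth tnth_mktuple frobenius_sum.
rewrite rmorphM [X in _ * X]raddf_sum [X in _ * X]big1 ?mulr0 // => i _ /=.
rewrite exprZn linearZ /=; have /eqP -> : tpi ('X_i ^+ (q ^ m)) == 0.
  rewrite tpi_eq0 mpolyXn; apply: frob_ideal_monomial; exists i.
  by rewrite mulmnE mnm1E eqxx mul1n.
by rewrite scaler0.
Qed.

Lemma trunc_act_pi s p : trunc_act s (tpi p) = tpi (gl_subst s p).
Proof.
apply/eqP; rewrite tpi_eq /gl_subst -raddfB; apply: gl_subst_ideal.
by rewrite -tpi_eq treprK.
Qed.

Fact trunc_act_is_linear s : linear (trunc_act s).
Proof.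
move=> a u v; rewrite -[u]treprK -[v]treprK -linearP !trunc_act_pi.
by rewrite /gl_subst !linearP.
Qed.

HB.instance Definition _ s :=
  GRing.isLinear.Build F trunc_poly trunc_poly _ (trunc_act s)
    (trunc_act_is_linear s).

(* Upper triangular; [is_trig_mx] means lower triangular. *)
Definition borel : pred 'M[F]_n :=
  [pred s | (s \in unitmx) && is_trig_mx s^T].

Lemma borelP (s : 'M[F]_n) :
  reflect (s \in unitmx /\ forall i j : 'I_n, (j < i)%N -> s i j = 0)
          (s \in borel).
Proof.
apply: (iffP andP) => -[us] => [/is_trig_mxP ts|ts]; split=> //.
  by move=> i j /ts; rewrite mxE.
by apply/is_trig_mxP => i j /ts; rewrite mxE.
Qed.

Definition borel_invariants : {vspace trunc_poly} :=
  (\bigcap_(s in borel) fixedSpace (linfun (trunc_act s)))%VS.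

Lemma borel_invariantsP (u : trunc_poly) :
  reflect (forall s, s \in borel -> trunc_act s u = u)
          (u \in borel_invariants).
Proof.
rewrite memvE; apply: (iffP subv_bigcapP) => inv s /inv.
  by rewrite -memvE => /fixedSpaceP; rewrite lfunE.
by move=> us; rewrite -memvE; apply/fixedSpaceP; rewrite lfunE.
Qed.

(* Spanned by the images of the degree [d] monomials; [trunc_degreeP] identifies
   it with the image of the homogeneous polynomials of degree [d]. *)
Definition trunc_degree (d : nat) : {vspace trunc_poly} :=
  <<[seq tpi 'X_[k]
     | k : 'X_{1..n < d.+1} in [pred k : 'X_{1..n < d.+1} | mdeg k == d]]>>%VS.

Lemma trunc_degreeP d (u : trunc_poly) :
  reflect (exists2 p : {mpoly F[n]}, p \is d.-homog & u = tpi p)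
          (u \in trunc_degree d).
Proof.
apply: (iffP idP) => [|[p homp ->]].
  rewrite /trunc_degree -[X in <<X>>%VS]in_tupleE; set b := in_tuple _.
  move/coord_span => ->.
  suff [p homp ep] : exists2 p : {mpoly F[n]}, p \is d.-homog &
      \sum_i coord b i u *: b`_i = tpi p by exists p.
  elim/big_ind: _ => [|_ _ [p hp ->] [r hr ->]|i _].
  - by exists 0; rewrite ?dhomog0 ?raddf0.
  - by exists (p + r); rewrite ?rpredD ?raddfD.
  have /imageP[k /eqP dk ->] : b`_i \in b by rewrite mem_nth.
  exists (coord b i u *: 'X_[k]); last by rewrite linearZ.
  by rewrite rpredZ // dhomogX; apply/eqP.
rewrite [p]mpolyE raddf_sum big_seq; apply: rpred_sum => k /= kp.
rewrite linearZ rpredZ //=; apply: memv_span.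
have dk : mdeg k = d by move/dhomogP: homp => /(_ _ kp).
have lk : (mdeg k < d.+1)%N by rewrite dk.
by apply/imageP; exists (BMultinom lk); rewrite //= inE dk.
Qed.

Lemma trunc_degree_eq0 d : (n * q ^ m < d)%N -> trunc_degree d = 0%VS.
Proof.
move=> ltd; apply/eqP; rewrite -subv0; apply/subvP => u /trunc_degreeP[p hp ->].
rewrite memv0 tpi_eq0; apply/frob_idealPcoef => k ltk.
apply: (dhomog_nemf_coeff hp); have : (mdeg k < d)%N; last by move/ltn_eqF->.
rewrite mdegE (leq_ltn_trans _ ltd) // -[n in leqRHS]card_ord -sum_nat_const.
by apply: leq_sum => i _; apply/ltnW.
Qed.

(* The coefficients beyond this truncation vanish, by [coef_hilbert_series]. *)
Definition hilbert_series : {poly rat} :=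
  \poly_(d < (n * q ^ m).+1) (\dim (borel_invariants :&: trunc_degree d))%:R.

Lemma coef_hilbert_series d :
  hilbert_series`_d = (\dim (borel_invariants :&: trunc_degree d))%:R.
Proof.
rewrite coef_poly ltnS; case: leqP => // /trunc_degree_eq0 ->.
by rewrite capv0 dimv0.
Qed.

End TruncatedPolynomials.

Section QTMultinomial.

Variable q : nat.

Definition ratfun : fieldType := {fraction {poly rat}}.
Definition tvar : ratfun := tofrac 'X.

(* The sum of the first [i] parts of [a], that is, $A_i$. *)
Definition psum (a : seq nat) (i : nat) : nat := sumn (take i a).

Definition qt_multinomial (a : seq nat) : ratfun :=
  let k := sumn a in
  (\prod_(0 <= j < k) (1 - tvar ^+ (q ^ k - q ^ j))) /
  (\prod_(0 <= i < size a) \prod_(1 <= j < (nth 0%N a i).+1)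
      (1 - tvar ^+ (q ^ psum a i.+1 - q ^ (psum a i.+1 - j)))).

Lemma tvar_factor_neq0 d : (0 < d)%N -> 1 - tvar ^+ d != 0.
Proof.
move=> d_gt0; rewrite /tvar -tofracXn -tofrac1 -tofracB tofrac_eq0.
by rewrite -oppr_eq0 opprB -size_poly_gt0 size_XnsubC.
Qed.

Lemma qt_multinomial_denom_neq0 a : (1 < q)%N ->
  \prod_(0 <= i < size a) \prod_(1 <= j < (nth 0%N a i).+1)
      (1 - tvar ^+ (q ^ psum a i.+1 - q ^ (psum a i.+1 - j))) != 0.
Proof.
move=> q1; rewrite big_nat prodf_seq_neq0; apply/allP => i _.
apply/implyP => /andP[_ lti].
rewrite big_nat prodf_seq_neq0; apply/allP => j _; apply/implyP => /andP[j0 lej].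
apply: tvar_factor_neq0; rewrite subn_gt0 ltn_exp2l //.
rewrite ltn_subrL j0 /psum (take_nth 0%N lti) sumn_rcons.
by rewrite /= addn_gt0 (leq_trans j0 lej) orbT.
Qed.

(* $e(m,1^n,\beta)$ with $n$ the length of [b]; truncated subtraction is exact
   when [b] has entries at most 1 and sum at most [m]. *)
Definition e_exponent (m : nat) (b : seq nat) : nat :=
  (\sum_(0 <= i < size b) (1 - nth 0 b i) * (q ^ m - q ^ psum b i.+1))%N.

End QTMultinomial.

(* Main.v *)
Require Import Defs.
From HB Require Import structures.
From mathcomp Require Import all_boot all_order all_algebra.
From mathcomp Require Import abelian finfield.
From mathcomp Require Import mpoly ring zify.

Set Implicit Arguments.
Unset Strict Implicit.
Unset Printing Implicit Defensive.

Import Order.TTheory GRing.Theory Num.Theory.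
Local Open Scope ring_scope.

(** Write H(m,n) for the Hilbert series of the invariants.  Splitting off the
    first entry of beta shows that the right-hand side satisfies

      H(m,n)(t) = t^(q^m-1) H(m,n-1)(t)
                  + (1-t^(q^m-1))/(1-t^(q-1)) H(m-1,n-1)(t^q),

    the quotient being the polynomial in t^(q-1) with (q^m-1)/(q-1) terms; the
    solution of this recursion is [hilb] ([sum_weight]).  The theorem says that
    the invariants have this Hilbert series ([hilbert_seriesE]), which follows
    from an upper bound in each degree and a lower bound for the total
    dimension that agrees with the sum of the upper bounds.

    Upper bound ([hdim_recursion]).  Filter the invariants by their order a in
    the first variable x_1 and take the leading coefficient, a polynomial in
    the other variables.  It is invariant under the smaller Borel group.  If
    a < q^m-1, the torus forces (q-1) | a, and the substitutions
    x_j -> x_j + x_1, read off in x_1-degree a+1, ..., a+q-1, force every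
    exponent of the leading coefficient to be divisible by q ([lead_torus],
    [lead_exponent]); so the leading coefficient is h(x_2^q,...,x_n^q) with h
    an invariant for (m-1,n-1).  If a = q^m-1 it is an invariant for (m,n-1).
    This bounds dimensions by the coefficients of the recursion.

    Lower bound ([dim_borel_invariants]).  The truncated algebra is the fibre
    at z = 0 of a family: choose q^m points of F[z], all vanishing at z = 0 and
    forming an F-space W of dimension m, and replace the relations x_j^(q^m) = 0
    by the vanishing of prod_(w in W) (x_j - w).  The linear group still acts,
    and for generic z the algebra is that of all functions on W^n, where the
    dimension of the invariants is the number of orbits of the Borel group on
    W^n.  Ranks can only drop at z = 0, so invariants can only gain dimension
    there ([rank_specialization]).  Counting orbits, by whether the first vector
    is zero or spans one of the (q^m-1)/(q-1) lines of W, gives the recursion at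
    t = 1 ([orbit_representatives]).

    Hence the total dimension is at least the value at 1 of [hilb], while each
    homogeneous piece has at most the dimension that [hilb] predicts; so all
    these inequalities are equalities. *)

(** * Orbits of the Borel group on matrices *)

(** The number (q^m - 1) / (q - 1) of lines in F^m, in the form given by [qintE]. *)
Definition qint (q m : nat) : nat := \sum_(i < m) q ^ i.

Lemma qintE q m : (0 < q)%N -> (qint q m * q.-1 = (q ^ m).-1)%N.
Proof.
by move=> q0; rewrite mulnC /qint; case: q q0 => // q _; rewrite predn_exp.
Qed.

(** The recursion obeyed by the number of orbits of the Borel group on m x n
    matrices: the first column is zero, or it spans a line, and the other columns
    then count modulo that line. *)
Fixpoint norbits (q m n : nat) : nat :=
  if n is n'.+1 then (norbits q m n' + qint q m * norbits q m.-1 n')%N else 1%N.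

Section Orbits.
Variable F : finFieldType.

(** The shape of the elements of the Borel group when the first variable is split
    off; see [borel_flag_mx] and [borel_flag_mxP]. *)
Definition flag_mx n (a : F) (r : 'rV[F]_n) (s : 'M[F]_n) : 'M[F]_n.+1 :=
  block_mx (a%:M : 'M_1) r 0 s.

Lemma borel_flag_mx n (a : F) (r : 'rV[F]_n) (s : 'M[F]_n) :
  flag_mx a r s \in @borel F n.+1 = (a != 0) && (s \in @borel F n).
Proof.
rewrite /flag_mx; apply/borelP/andP => [[us ts]|[a0 /borelP[us ts]]].
  move: us; rewrite unitmxE (det_ublock (a%:M : 'M_1)) det_scalar1 unitrM unitfE.
  case/andP=> a0 us; split=> //; apply/borelP; split=> [|i j ltji].
    by rewrite unitmxE.
  have := ts (lift ord0 i) (lift ord0 j); rewrite /= ltnS => /(_ ltji).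
  rewrite -[lift ord0 i]rshift1 -[lift ord0 j]rshift1.
  by rewrite (block_mxEdr (a%:M : 'M_1)).
split.
  by rewrite unitmxE (det_ublock (a%:M : 'M_1)) det_scalar1 unitrM unitfE a0 -unitmxE.
move=> i j; case: (unliftP ord0 i) => [i'|] -> //.
case: (unliftP ord0 j) => [j'|] -> ltji.
  rewrite -[lift ord0 i']rshift1 -[lift ord0 j']rshift1.
  by rewrite (block_mxEdr (a%:M : 'M_1)) ts.
rewrite -[lift ord0 i']rshift1.
have -> : (ord0 : 'I_n.+1) = lshift n (0 : 'I_1) by apply: val_inj.
by rewrite (block_mxEdl (a%:M : 'M_1)) mxE.
Qed.

Lemma borel_flag_mxP n (s : 'M[F]_n.+1) : s \in @borel F n.+1 ->
  exists a r s', [/\ s = flag_mx a r s', a != 0 & s' \in @borel F n].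
Proof.
move=> bs; have es := submxK (s : 'M_(1 + n)).
have dl0 : dlsubmx (s : 'M_(1 + n)) = 0.
  by apply/matrixP => i j; rewrite !mxE ord1; case/borelP: bs => _; apply.
move: es bs; rewrite dl0 [ulsubmx _]mx11_scalar -/(flag_mx _ _ _) => <-.
rewrite borel_flag_mx => /andP[a0 bs].
by exists (ulsubmx (s : 'M_(1 + n)) 0 0), (ursubmx (s : 'M_(1 + n))), (drsubmx (s : 'M_(1 + n))).
Qed.

(** Any choice of a nonzero coordinate would do, as long as it depends on the line
    spanned by v only; this is [pivotZ]. *)
Definition pivot m (v : 'cV[F]_m.+1) : 'I_m.+1 :=
  odflt ord0 [pick i | v i 0 != 0].

Lemma pivotZ m (v : 'cV[F]_m.+1) a : a != 0 -> pivot (a *: v) = pivot v.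
Proof.
move=> a0; rewrite /pivot; congr odflt; apply: eq_pick => i /=.
by rewrite !mxE mulf_eq0 (negPf a0).
Qed.

Lemma pivotP m (v : 'cV[F]_m.+1) : v != 0 -> v (pivot v) 0 != 0.
Proof.
move=> v0; rewrite /pivot; case: pickP => //= vz; case/eqP: v0.
by apply/colP => i; rewrite mxE; move/eqP: (vz i).
Qed.

Definition normalized m : {set 'cV[F]_m.+1} := [set v : 'cV[F]_m.+1 | v (pivot v) 0 == 1].

(** Dividing a nonzero vector by its pivot coordinate identifies the nonzero
    vectors with pairs of a normalized vector and a nonzero scalar. *)
Lemma card_normalized m : (qint #|F| m.+1 <= #|normalized m|)%N.
Proof.
have q1 := card_finNzRing_gt1 F.
have q0 : (0 < #|F|.-1)%N by rewrite -subn1 subn_gt0.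
rewrite -(leq_pmul2r q0) qintE ?(ltnW q1) //.
have -> : #|F|.-1 = #|[set c : F | c != 0]|.
  by have /eqP := cardsC1 (0 : F) => /eqP <-; apply: eq_card => c; rewrite !inE.
rewrite -cardsX.
have -> : (#|F| ^ m.+1).-1 = #|[set v : 'cV[F]_m.+1 | v != 0]|.
  have := cardsC1 (0 : 'cV[F]_m.+1); rewrite card_mx muln1 => <-.
  by apply: eq_card => v; rewrite !inE.
pose f (v : 'cV[F]_m.+1) := ((v (pivot v) 0)^-1 *: v, v (pivot v) 0).
rewrite -(card_in_imset (f := f)); last first.
  move=> u v; rewrite !inE => /pivotP u0 /pivotP v0 [e1 e2].
  by rewrite -[u]scale1r -(divff u0) -scalerA e1 e2 scalerA divff // scale1r.
apply/subset_leq_card/subsetP => _ /imsetP[v + ->]; rewrite !inE /f /= => /pivotP v0.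
by rewrite v0 andbT pivotZ ?invr_eq0 // mxE mulVf.
Qed.

Lemma normalized_line m (u v : 'cV[F]_m.+1) a :
  u \in normalized m -> v \in normalized m -> v = a *: u -> a = 1.
Proof.
rewrite !inE => /eqP u1 /eqP v1 e; have a0 : a != 0.
  by apply: contraTneq isT => a0; move: v1; rewrite e a0 scale0r mxE => /esym/eqP; rewrite oner_eq0.
by move: v1; rewrite e pivotZ // mxE u1 mulr1.
Qed.

(** The matrices whose i-th row vanishes represent the columns modulo a line whose
    i-th coordinate is nonzero. *)
Definition insert_row m n (i : 'I_m.+1) (Z : 'M[F]_(m, n)) : 'M[F]_(m.+1, n) :=
  \matrix_(k, l) if unlift i k is Some k' then Z k' l else 0.

Lemma insert_rowK m n (i : 'I_m.+1) : cancel (@insert_row m n i) (row' i).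
Proof. by move=> Z; apply/matrixP => k l; rewrite !mxE liftK. Qed.

Lemma row_insert_row m n (i : 'I_m.+1) (Z : 'M[F]_(m, n)) : row i (insert_row i Z) = 0.
Proof. by apply/rowP => l; rewrite !mxE unlift_none. Qed.

Definition inequivalent m n (S : {set 'M[F]_(m, n)}) :=
  forall X s, X \in S -> s \in @borel F n -> X *m s \in S -> X *m s = X.

Lemma eq_row_mx1 m n (v v' : 'cV[F]_m) (X X' : 'M[F]_(m, n)) :
  row_mx v X = row_mx v' X' :> 'M_(m, n.+1) -> v = v' /\ X = X'.
Proof. exact: (@eq_row_mx F m 1 n). Qed.

(** Representatives are built column by column.  If the first column v is
    normalized, subtracting multiples of v makes the other columns vanish in the
    pivot row of v, after which the other rows run through representatives with
    one row less.  Two such matrices in one orbit share v, because v spans a line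
    fixed by the group, and comparing pivot rows shows that no multiple of v is
    added to the other columns. *)
Lemma orbit_representatives m n :
  exists2 S : {set 'M[F]_(m, n)}, (norbits #|F| m n <= #|S|)%N & inequivalent S.
Proof.
elim: n m => [|n IHn] m.
  exists [set 0]; first by rewrite cards1.
  by move=> X s; rewrite !inE => /eqP-> _ /eqP.
have [S cS iS] := IHn m.
pose S1 : {set 'M[F]_(m, n.+1)} := [set row_mx (0 : 'cV_m) X | X in S].
have cS1 : #|S1| = #|S|.
  by rewrite card_imset // => X Y; case/eq_row_mx1.
have iS1 X s : X \in S1 -> s \in @borel F n.+1 ->
   (X *m s \in S1 -> X *m s = X) /\
   lsubmx (X *m s : 'M_(m, 1 + n)) = 0.
  case/imsetP=> X' X'S -> /borel_flag_mxP[a [r [s' [-> a0 bs]]]].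
  rewrite /flag_mx (mul_row_block _ _ (a%:M : 'M_1)) !mul0mx mulmx0 !add0r row_mxKl; split=> //.
  case/imsetP=> Y YS /eq_row_mx1[_ e]; by rewrite iS // e.
case: m => [|m] in S cS iS S1 cS1 iS1 *.
  exists S1; first by rewrite /= /qint big_ord0 addn0 cS1.
  by move=> X s XS bs; case: (iS1 X s XS bs).
have [T cT iT] := IHn m.
pose f (p : 'cV[F]_m.+1 * 'M[F]_(m, n)) : 'M[F]_(m.+1, n.+1) :=
  row_mx p.1 (insert_row (pivot p.1) p.2).
pose S2 := [set f p | p in setX (normalized m) T].
have fI : injective f.
  move=> [v Z] [v' Z']; case/eq_row_mx1=> /= <- /(congr1 (row' (pivot v))).
  by rewrite !insert_rowK => ->.
have nz v : v \in normalized m -> v != 0.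
  by apply: contraTneq => ->; rewrite inE mxE eq_sym oner_eq0.
exists (S1 :|: S2).
  rewrite cardsU disjoint_setI0 ?cards0 ?subn0.
    by rewrite cS1 card_imset // cardsX leq_add // leq_mul // card_normalized.
  rewrite disjoint_subset; apply/subsetP => _ /imsetP[X _ ->].
  apply/imsetP => -[[v Z]]; rewrite inE /= => /andP[/nz v0 _] /eq_row_mx1[/= e _].
  by rewrite -e eqxx in v0.
move=> X s + bs; case/setUP=> [XS|].
  have [i1 i2] := iS1 X s XS bs; case/setUP=> // /imsetP[[v Z]].
  rewrite inE /= => /andP[/nz v0 _] e; move: i2; rewrite e row_mxKl /= => vz.
  by rewrite vz eqxx in v0.
case/imsetP=> [[v Z]]; rewrite inE /= => /andP[nv ZT] ->.
case/borel_flag_mxP: bs => [a [r [s' [-> a0 bs]]]].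
rewrite /flag_mx (mul_row_block _ _ (a%:M : 'M_1)) mulmx0 addr0 mul_mx_scalar.
case/setUP=> /imsetP.
  case=> Y YS /eq_row_mx1[/= /eqP e _]; move: e.
  by rewrite scaler_eq0 (negPf a0) (negPf (nz _ nv)).
case=> [[v' Z']]; rewrite inE /= => /andP[nv' Z'T] e; move: (e).
case/eq_row_mx1=> /= e1 e2; rewrite e /f /=.
have a1 := normalized_line nv nv' (esym e1).
move: e1 e2; rewrite a1 scale1r => <- e2.
(* The pivot row of this identity reads 0 = r, since v has pivot entry 1. *)
move: (congr1 (row (pivot v)) e2).
rewrite linearD /= !row_mul !row_insert_row mul0mx addr0.
have -> : row (pivot v) v = 1%:M.
  by apply/rowP => j; rewrite ord1 !mxE eqxx; move: nv; rewrite inE => /eqP.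
rewrite mul1mx => r0; move: e2; rewrite r0 mulmx0 add0r => e2.
have e3 : Z *m s' = Z'.
  rewrite -(insert_rowK (pivot v) Z') -e2; apply/matrixP => i j.
  by rewrite !mxE; apply: eq_bigr => k _; rewrite !mxE liftK.
by move: (iT _ _ ZT bs); rewrite e3 => ->.
Qed.
End Orbits.

(** * Invariants of a deformation

    The matrix S at z = 0 has a minor, in suitable bases, equal to 1; the same
    minor of S is a polynomial in z with value 1 at 0, hence nonzero. *)
Lemma rank_specialization (F : fieldType) a b (S : 'M[{poly F}]_(a, b)) :
  (\rank (map_mx (horner_eval 0) S) <= \rank (map_mx (@tofrac _) S))%N.
Proof.
set S0 := map_mx _ S; set r := \rank S0.
pose L : 'M[F]_(r, a) := pinvmx (col_base S0).
pose R : 'M[F]_(b, r) := pinvmx (row_base S0).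
have LSR : L *m S0 *m R = 1%:M.
  transitivity (L *m (col_base S0 *m row_base S0) *m R); first by rewrite mulmx_base.
  rewrite (mulmxA L) /L mulVpmx ?col_base_full // mul1mx.
  by rewrite mulmxVp ?row_base_free.
pose M := map_mx polyC L *m S *m map_mx polyC R.
have M0 : map_mx (horner_eval 0) M = 1%:M.
  have cst c d (A : 'M[F]_(c, d)) : map_mx (horner_eval 0) (map_mx polyC A) = A.
    by apply/matrixP => i j; rewrite !mxE; apply: hornerC.
  by rewrite !map_mxM !cst.
have dM : \det (map_mx (@tofrac _) M) != 0.
  rewrite det_map_mx tofrac_eq0; apply: contraTneq isT => dM.
  have := det_map_mx (horner_eval 0) M; rewrite M0 det1 dM rmorph0.
  by move/eqP; rewrite oner_eq0.
have : \rank (map_mx (@tofrac _) M) = r.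
  by apply: mxrank_unit; rewrite unitmxE unitfE.
rewrite !map_mxM => <-.
by apply: (leq_trans (mxrankM_maxl _ _)); apply: mxrankM_maxr.
Qed.

Lemma sum_enum_val (R : nmodType) (T : finType) (f : T -> R) :
  \sum_(k < #|{: T}|) f (enum_val k) = \sum_x f x.
Proof. by rewrite [RHS](reindex _ (onW_bij _ (@enum_val_bij T))). Qed.

Section Lagrange.
Variables (K : fieldType) (T : finType) (x : T -> K).

Definition lagrange (v : T) : {poly K} :=
  \prod_(u | u != v) ((x v - x u)^-1 *: ('X - (x u)%:P)).

Lemma size_lagrange v : (size (lagrange v) <= #|T|)%N.
Proof.
rewrite /lagrange scaler_prod; apply: leq_trans (size_scale_leq _ _) _.
rewrite -big_filter size_prod_XsubC size_filter.
rewrite (_ : count _ _ = #|T|.-1) ?prednK //; last first.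
  by rewrite -(cardC1 v) -sum1_count -sum1_card; apply: eq_bigl.
by apply/card_gt0P; exists v.
Qed.

Lemma lagrange_eval u v : injective x -> (lagrange u).[x v] = (u == v)%:R.
Proof.
move=> injx; rewrite /lagrange horner_prod; case: (eqVneq u v) => [<-|uv].
  rewrite big1 // => t tu; rewrite hornerZ hornerXsubC mulVf //.
  by rewrite subr_eq0 (inj_eq injx) eq_sym.
rewrite (bigD1 v) 1?eq_sym //= hornerZ hornerXsubC.
by rewrite subrr mulr0 mul0r.
Qed.

End Lagrange.

Section Interpolation.
Variables (F : finFieldType) (m n : nat).
Local Notation Q := (#|F| ^ m)%N.
Local Notation bexp := {ffun 'I_n -> 'I_Q}.
Local Notation K := {fraction {poly F}}.
Local Notation b := (@bounded_mnm F m n).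

(** The points of W.  The shift to z^(i+1) makes every point vanish at z = 0, so
    that the deformed relation below specializes to x^(q^m) = 0. *)
Definition point (v : 'cV[F]_m) : {poly F} := \sum_i v i 0 *: 'X^(i.+1).

Lemma point_coef v (i : 'I_m) : (point v)`_i.+1 = v i 0.
Proof.
rewrite /point coef_sum (bigD1 i) //= coefZ coefXn eqxx mulr1 big1 ?addr0 // => j.
by move=> ij; rewrite coefZ coefXn eqSS -val_eqE eq_sym in ij *; rewrite (negPf ij) mulr0.
Qed.

Lemma point_inj : injective point.
Proof. by move=> u v e; apply/colP => i; rewrite -!point_coef e. Qed.

Lemma point0 v : (point v).[0] = 0.
Proof.
rewrite /point horner_sum big1 // => i _.
by rewrite hornerZ hornerXn expr0n mulr0.
Qed.

(** Evaluating the image of x_j under s at a tuple of points is evaluating x_j at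
    the translated tuple: this turns the action on polynomials into a
    permutation of W^n, identified with m x n matrices acted on from the right. *)
Lemma point_mul (X : 'M[F]_(m, n)) (s : 'M_n) j :
  point (col j (X *m s)) = \sum_i (s i j)%:P * point (col i X).
Proof.
rewrite /point; under eq_bigr do rewrite !mxE scaler_suml.
rewrite exchange_big /=; apply: eq_bigr => i _.
rewrite mulr_sumr; apply: eq_bigr => k _.
by rewrite !mxE mul_polyC scalerA mulrC.
Qed.

Definition point_poly : {poly {poly F}} := \prod_(v : 'cV[F]_m) ('X - (point v)%:P).

Lemma card_points : #|{: 'cV[F]_m}| = Q.
Proof. by rewrite card_mx muln1. Qed.

Lemma point_poly_monic : point_poly \is monic. Proof. exact: monic_prod_XsubC. Qed.

Lemma size_point_poly : size point_poly = Q.+1.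
Proof. by rewrite /point_poly size_prod_XsubC -card_points cardT enumT. Qed.

Lemma point_poly_root v : point_poly.[point v] = 0.
Proof. by rewrite /point_poly horner_prod (bigD1 v) //= hornerXsubC subrr mul0r. Qed.

(** At z = 0 all points collide, and the deformed relation becomes x^(q^m). *)
Lemma point_poly0 : map_poly (horner_eval 0) point_poly = 'X^Q.
Proof.
rewrite /point_poly rmorph_prod /=.
under eq_bigr do rewrite rmorphB /= map_polyX map_polyC /= /horner_eval point0 subr0.
by rewrite prodr_const cardT /= -cardE card_points.
Qed.

Definition reduceX k : {poly {poly F}} := Pdiv.CommonRing.rmodp 'X^k point_poly.

Lemma size_reduceX k : (size (reduceX k) <= Q)%N.
Proof.
rewrite -ltnS -size_point_poly; apply: Pdiv.CommonRing.ltn_rmodpN0.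
exact: monic_neq0 point_poly_monic.
Qed.

Lemma reduceX_eval k v : (reduceX k).[point v] = point v ^+ k.
Proof.
rewrite -[RHS]hornerXn [X in _ = X.[_]](Pdiv.RingMonic.rdivp_eq point_poly_monic 'X^k).
by rewrite hornerD hornerM point_poly_root mulr0 add0r.
Qed.

Lemma reduceX0 k i : (i < Q)%N -> ((reduceX k)`_i).[0] = (k == i)%:R.
Proof.
move=> ltiQ; have := Pdiv.RingMonic.rdivp_eq point_poly_monic 'X^k.
move/(congr1 (fun p => (map_poly (horner_eval 0) p)`_i)).
rewrite rmorphD rmorphM /= point_poly0 map_polyXn coefD coefMXn ltiQ add0r coefXn.
by rewrite coef_map /= eq_sym => ->.
Qed.

Definition evalp (p : {mpoly F[n]}) (X : 'M[F]_(m, n)) : {poly F} :=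
  mmap polyC (fun j => point (col j X)) p.

Lemma evalpX k X : evalp 'X_[k] X = \prod_j point (col j X) ^+ k j.
Proof. by rewrite /evalp mmapX. Qed.

Lemma evalp_subst s p X : evalp (gl_subst s p) X = evalp p (X *m s).
Proof.
rewrite /gl_subst comp_mpolyEX [in RHS](mpolyE p) /evalp !raddf_sum.
apply: eq_bigr => k _ /=; rewrite !mmapZ comp_mpolyX mmapX; congr (_ * _).
rewrite rmorph_prod; apply: eq_bigr => j _; rewrite rmorphXn /=; congr (_ ^+ _).
rewrite tnth_mktuple raddf_sum point_mul; apply: eq_bigr => i _ /=.
by rewrite mmapZ mmapX mmap1U.
Qed.

(** Coordinates, in the basis of bounded monomials, of the class of p in the
    deformed algebra. *)
Definition reduce (p : {mpoly F[n]}) (e : bexp) : {poly F} :=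
  \sum_(k <- msupp p) (p@_k)%:P * \prod_j (reduceX (k j))`_(e j).

(** At z = 0 this is truncation, the coordinate map of the algebra of the theorem. *)
Lemma reduce0 p e : (reduce p e).[0] = p@_(b e).
Proof.
rewrite [in RHS](mpolyE p) raddf_sum /reduce horner_sum; apply: eq_bigr => k _ /=.
rewrite hornerM hornerC mcoeffZ mcoeffX horner_prod; congr (_ * _).
under eq_bigr do rewrite reduceX0 //.
case: eqP => [->|ne]; first by rewrite big1 // => j _; rewrite mnmE eqxx.
have [j nj] : exists j, k j != e j.
  apply/existsP; apply: contraPT ne; rewrite negb_exists => /forallP h; apply.
  by apply/mnmP => j; rewrite mnmE; apply/eqP; have := h j; rewrite negbK.
by rewrite (bigD1 j) //= (negPf nj) mul0r.
Qed.

Lemma prod_sum_bexp (R : comNzRingType) (p : 'I_n -> {poly R}) (x : 'I_n -> R) :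
  (forall j, size (p j) <= Q)%N ->
  \sum_(e : bexp) (\prod_j (p j)`_(e j)) * (\prod_j x j ^+ e j) =
  \prod_j (p j).[x j].
Proof.
move=> sp; transitivity (\prod_j \sum_(i < Q) (p j)`_i * x j ^+ i).
  by rewrite bigA_distr_bigA; apply: eq_bigr => e _; rewrite big_split.
by apply: eq_bigr => j _; rewrite (horner_coef_wide _ (sp j)).
Qed.

Lemma reduce_eval p X : \sum_e reduce p e * evalp 'X_[b e] X = evalp p X.
Proof.
rewrite [in RHS](mpolyE p) /evalp raddf_sum /reduce.
under eq_bigr do rewrite mulr_suml.
rewrite exchange_big /=; apply: eq_bigr => k _.
rewrite mmapZ mmapX /mmap1 -/(evalp _ _).
under eq_bigr => e _.
  rewrite -/(evalp _ _) evalpX -mulrA; under [X in _ * (_ * X)]eq_bigr do rewrite mnmE.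
  over.
rewrite -mulr_sumr prod_sum_bexp => [|j]; last exact: size_reduceX.
by congr (_ * _); apply: eq_bigr => j _; rewrite reduceX_eval.
Qed.

Definition fpoint (v : 'cV[F]_m) : K := tofrac (point v).

Lemma fpoint_inj : injective fpoint.
Proof. by move=> u v /eqP; rewrite /fpoint tofrac_eq => /eqP/point_inj. Qed.

Definition eval_mx : 'M[K]_(#|{: bexp}|, #|{: 'M[F]_(m, n)}|) :=
  \matrix_(i, j) tofrac (evalp 'X_[b (enum_val i)] (enum_val j)).

Definition interp_mx : 'M[K]_(#|{: 'M[F]_(m, n)}|, #|{: bexp}|) :=
  \matrix_(i, j) \prod_l (lagrange fpoint (col l (enum_val i)))`_((enum_val j : bexp) l).

(** Products of one-variable Lagrange polynomials are the indicator functions of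
    the points of W^n. *)
Lemma interp_mxK : interp_mx *m eval_mx = 1%:M.
Proof.
apply/matrixP => i j; rewrite !mxE.
under eq_bigr => k _ do rewrite !mxE.
rewrite (sum_enum_val (fun e : bexp => (\prod_l (lagrange fpoint (col l (enum_val i)))`_(e l))
   * tofrac (evalp 'X_[b e] (enum_val j)))) /=.
under eq_bigr => e _.
  rewrite evalpX rmorph_prod; under [X in _ * X]eq_bigr do rewrite mnmE rmorphXn /= -/(fpoint _).
  over.
rewrite prod_sum_bexp => [|l]; last first.
  by rewrite -card_points size_lagrange.
under eq_bigr do rewrite (lagrange_eval _ _ fpoint_inj).
case: eqP => [->|ne]; first by rewrite big1 // => l _; rewrite eqxx.
have [l nl] : exists l, col l (enum_val i) != col l (enum_val j).
  apply/existsP; apply: contraPT ne; rewrite negb_exists => /forallP h; apply.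
  apply: enum_val_inj; apply/matrixP => x l.
  by have := h l; rewrite negbK => /eqP/colP/(_ x); rewrite !mxE.
by rewrite (bigD1 l) //= (negPf nl) mul0r.
Qed.

Lemma card_bexp : #|{: bexp}| = #|{: 'M[F]_(m, n)}|.
Proof. by rewrite card_ffun !card_ord card_mx expnM. Qed.

(** Interpolation gives surjectivity onto the functions on W^n; bounded exponents
    and points are equinumerous, so a polynomial with bounded exponents that
    vanishes on W^n is zero. *)
Lemma eval_mx_free : row_free eval_mx.
Proof.
have : row_full eval_mx by apply/row_fullP; exists interp_mx; apply: interp_mxK.
by rewrite /row_full /row_free => /eqP ->; rewrite card_bexp.
Qed.

Lemma borel_mul (s t : 'M[F]_n) : s \in @borel F n -> t \in @borel F n ->
  s *m t \in @borel F n.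
Proof.
move=> /borelP[us ts] /borelP[ut tt]; apply/borelP.
split=> [|i j ltji]; first by rewrite unitmx_mul us.
rewrite mxE big1 // => k _; case: (ltnP k i) => [/ts ->|leik]; rewrite ?mul0r //.
by rewrite tt ?mulr0 // (leq_trans ltji).
Qed.

(** Right multiplication by s permutes the finite Borel group, so every element t
    has the form u * s; this avoids inverting triangular matrices. *)
Lemma borel_div (s t : 'M[F]_n) : s \in @borel F n -> t \in @borel F n ->
  t *m invmx s \in @borel F n.
Proof.
move=> bs bt; have [us _] := borelP _ bs.
pose B := [set t : 'M[F]_n | t \in @borel F n].
have : [set t *m s | t in B] = B.
  apply/eqP; rewrite eqEcard card_imset ?leqnn ?andbT; last exact: can_inj (mulmxK us).
  by apply/subsetP => _ /imsetP[u + ->]; rewrite !inE => bu; apply: borel_mul.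
move/setP/(_ t); rewrite [t \in B]inE bt => /imsetP[u + ->].
by rewrite inE mulmxK.
Qed.

(** The matrices of s - 1 on the deformed algebra, for all s in the Borel group,
    side by side: the left kernel consists of the invariants.  A single matrix is
    needed to apply [rank_specialization]. *)
Definition moved_mx : 'M[{poly F}]_(#|{: bexp}|, #|{: 'M[F]_n * bexp}|) :=
  \matrix_(i, j) let: (s, e) := enum_val j in
    if s \in @borel F n then
      reduce (gl_subst s 'X_[b (enum_val i)]) e - (enum_val i == e)%:R
    else 0.

(** Over the fraction field the deformed algebra is the algebra of functions on
    W^n, and the indicator functions of the orbits of the elements of S are
    independent invariants. *)
Lemma rank_moved_mx (S : {set 'M[F]_(m, n)}) : inequivalent S ->
  (#|S| + \rank (map_mx (@tofrac _) moved_mx) <= #|{: bexp}|)%N.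
Proof.
move=> iS.
pose Ind : 'M[K]_(#|S|, #|{: 'M[F]_(m, n)}|) :=
  \matrix_(i, j) [exists s, (s \in @borel F n) && (enum_val i *m s == enum_val j)]%:R.
pose C : 'M[K]_(#|{: 'M[F]_(m, n)}|, #|S|) :=
  \matrix_(j, i) (enum_val j == enum_val i)%:R.
have IC : Ind *m C = 1%:M.
  apply/matrixP => i j; rewrite !mxE (bigD1 (enum_rank (enum_val j))) //=.
  rewrite !mxE enum_rankK eqxx mulr1 big1 ?addr0 => [|k nk]; last first.
    rewrite !mxE; case: eqP => [e|_]; last by rewrite mulr0.
    by case/eqP: nk; rewrite -e enum_valK.
  congr (_%:R); congr nat_of_bool; apply/existsP/eqP => [[s /andP[bs /eqP e]]|->].
    apply: enum_val_inj; rewrite -e; apply/esym; apply: iS => //; first exact: enum_valP.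
    by rewrite e enum_valP.
  exists 1%:M; rewrite mulmx1 eqxx andbT; apply/borelP; split=> [|k l ltlk].
    exact: unitmx1.
  by rewrite mxE -val_eqE gtn_eqF.
pose Y := Ind *m interp_mx.
have YM : Y *m eval_mx = Ind by rewrite -mulmxA interp_mxK mulmx1.
have fY : row_free Y by apply/row_freeP; exists (eval_mx *m C); rewrite mulmxA YM.
have Y0 : Y *m map_mx (@tofrac _) moved_mx = 0.
  apply/matrixP => i j; rewrite [RHS]mxE mxE.
  case ej: (enum_val j) => [s e].
  case bs: (s \in @borel F n); last first.
    by rewrite big1 // => k _; rewrite !mxE ej bs rmorph0 mulr0.
  pose A : 'M[K]_(#|{: bexp}|) := \matrix_(k, l)
     tofrac (reduce (gl_subst s 'X_[b (enum_val k)]) (enum_val l)).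
  (* Both sides have the same values on W^n, as the indicators are invariant. *)
  have YA : Y *m A = Y.
    apply: (row_free_inj eval_mx_free); rewrite -mulmxA YM.
    have -> : A *m eval_mx = \matrix_(k, l)
        tofrac (evalp 'X_[b (enum_val k)] (enum_val l *m s)).
      apply/matrixP => k l; rewrite !mxE.
      under eq_bigr do rewrite !mxE -tofracM.
      rewrite -rmorph_sum (sum_enum_val (fun e => reduce (gl_subst s 'X_[b (enum_val k)]) e
         * evalp 'X_[b e] (enum_val l))) /=.
      by rewrite reduce_eval evalp_subst.
    apply/matrixP => k l; transitivity (Ind k (enum_rank (enum_val l *m s))).
      rewrite -YM !mxE; apply: eq_bigr => x _; rewrite !mxE; congr (_ * _).
      by rewrite enum_rankK.
    rewrite !mxE enum_rankK; congr (_%:R); congr nat_of_bool.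
    have [us _] := borelP _ bs.
    apply/existsP/existsP => -[t /andP[bt /eqP e']].
      exists (t *m invmx s); rewrite borel_div //=.
      by rewrite mulmxA e' mulmxK.
    by exists (t *m s); rewrite borel_mul //= mulmxA e'.
  pose l := enum_rank e.
  have := congr1 (fun Z : 'M_(_, _) => Z i l) YA; rewrite mxE => YAl.
  rewrite (eq_bigr (fun k => Y i k * A k l - Y i k * (k == l)%:R)); last first.
    move=> k _; rewrite [map_mx _ _ _ _]mxE !(mxE, ej) bs /= rmorphB /= mulrBr.
    by rewrite enum_rankK -(inj_eq enum_val_inj) enum_rankK rmorph_nat.
  rewrite big_split /= YAl sumrN (bigD1 l) //= eqxx mulr1 big1 ?addr0 ?subrr // => k nk.
  by rewrite (negPf nk) mulr0.
have /sub_kermxP/mxrankS := Y0; rewrite mxrank_ker.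
move/eqP: fY => ->; by rewrite leq_subRL ?rank_leq_row // addnC.
Qed.

(** A vector in the left kernel of [moved_mx] at z = 0 is the coordinate vector of
    an invariant, by [reduce0]; the rank bound over the fraction field passes to
    z = 0 by [rank_specialization]. *)
Lemma dim_borel_invariants :
  (norbits #|F| m n <= \dim (borel_invariants F m n))%N.
Proof.
have [S cS /rank_moved_mx iS] := orbit_representatives F m n.
apply: leq_trans cS _.
pose M0 := map_mx (horner_eval 0) moved_mx.
have rM : (#|S| <= \rank (kermx M0))%N.
  rewrite mxrank_ker leq_subRL ?rank_leq_row // addnC.
  by apply: leq_trans iS; rewrite leq_add2l rank_specialization.
apply: leq_trans rM _; set r := \rank _.
pose B : 'M[F]_(r, _) := row_base (kermx M0).
pose p (c : 'rV[F]_#|{: bexp}|) : {mpoly F[n]} := \sum_k c 0 k *: 'X_[b (enum_val k)].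
have p_coef c k : (p c)@_(b (enum_val k)) = c 0 k.
  rewrite /p raddf_sum (bigD1 k) //= mcoeffZ mcoeffX eqxx mulr1 big1 ?addr0 // => l nlk.
  rewrite mcoeffZ mcoeffX (inj_eq (@bounded_mnm_inj _ _ _)) (inj_eq enum_val_inj).
  by rewrite (negPf nlk) mulr0.
have trunc_eq (g h : {mpoly F[n]}) :
    (forall e, g@_(b e) = h@_(b e)) -> tpi m g = tpi m h.
  move=> gh; apply/eqP; rewrite tpi_eq; apply/frob_idealPcoef => k ltk.
  pose e : bexp := [ffun i => Ordinal (ltk i)].
  have -> : k = b e by apply/mnmP => i; rewrite mnmE ffunE.
  by rewrite mcoeffB gh subrr.
pose u (i : 'I_r) := tpi m (p (row i B)).
have uI i : u i \in borel_invariants F m n.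
  apply/borel_invariantsP => s bs; rewrite trunc_act_pi; apply: trunc_eq => e.
  have /sub_kermxP/matrixP/(_ 0 (enum_rank (s, e))) : (row i B <= kermx M0)%MS.
    by rewrite (submx_trans (row_sub i B)) // eq_row_base.
  rewrite mxE [RHS]mxE => h; apply/eqP; rewrite -subr_eq0; apply/eqP; rewrite -[RHS]h.
  rewrite /p /gl_subst (raddf_sum (comp_mpoly _)) !raddf_sum -big_split; apply: eq_bigr => k _ /=.
  rewrite [M0 _ _]mxE [moved_mx _ _]mxE enum_rankK bs /horner_eval hornerD hornerN reduce0 mulrBr.
  rewrite comp_mpolyZ !mcoeffZ mcoeffX (inj_eq (@bounded_mnm_inj _ _ _)).
  by case: eqP; rewrite hornerC ?horner0.
have fu : free [tuple u i | i < r].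
  apply/freeP => c; under eq_bigr do rewrite -tnth_nth tnth_mktuple.
  move=> c0 i; have /row_freeP[B' BB] : row_free B by apply: row_base_free.
  suff : (\row_j c j) *m B = 0.
    by move/(congr1 (mulmx^~ B')); rewrite -mulmxA BB mulmx1 mul0mx => /rowP/(_ i); rewrite !mxE.
  apply/rowP => k; rewrite [RHS]mxE.
  move: c0; rewrite /u; under eq_bigr do rewrite -linearZ.
  rewrite -raddf_sum => /eqP; rewrite tpi_eq0 => /frob_idealPcoef/(_ (b (enum_val k))).
  move=> /(_ (bounded_mnm_lt _)) <-; rewrite raddf_sum mxE; apply: eq_bigr => j _.
  by rewrite /= mcoeffZ p_coef !mxE.
have -> : r = size [tuple u i | i < r] by rewrite size_tuple.
rewrite -(eqP fu); apply/dimvS/span_subvP => _ /tnthP[i ->].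
by rewrite tnth_mktuple.
Qed.

End Interpolation.

(** * Expansion in the first variable *)

Section Frobenius.
Variable F : finFieldType.
Local Notation q := #|F|.

(** The order of F is a power of the characteristic, as the Frobenius identities require. *)
Lemma card_pnat (R : nzRingType) : [pchar R] =i [pchar F] -> [pchar R].-nat q.
Proof.
move=> eR; have [p pr_p pcharF] := finPcharP F.
rewrite (eq_pnat _ eR) (eq_pnat _ (pcharf_eq pcharF)) -cardsT.
by have := abelem_pgroup (fin_ring_pchar_abelem pcharF); rewrite /pgroup.pgroup => ->.
Qed.

Lemma coef_XaddC (R : comNzRingType) (c : R) N k :
  (('X + c%:P) ^+ N)`_k = c ^+ (N - k) *+ 'C(N, k).
Proof.
rewrite addrC exprDn coef_sum.
under eq_bigr => i _ do rewrite coefMn -rmorphXn /= coefCM coefXn.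
case: (ltnP k N.+1) => [lt|le].
  rewrite (bigD1 (Ordinal lt)) //= eqxx mulr1 big1 ?addr0 // => i.
  by rewrite -val_eqE /= eq_sym => /negPf->; rewrite mulr0 mul0rn.
rewrite bin_small // big1 // => i _; rewrite gtn_eqF ?mulr0 ?mul0rn //.
by rewrite (leq_trans (ltn_ord i)).
Qed.

(** The special case of Lucas' theorem for the base q: in characteristic p,
    (X+1)^(uq+k) = (X^q+1)^u (X+1)^k, and the first factor is 1 modulo X^q. *)
Lemma binomial_card (u k : nat) : (k < q)%N -> 'C(u * q + k, k)%:R != 0 :> F.
Proof.
move=> ltkq.
have eR : [pchar {poly F}] =i [pchar F] by apply: pchar_poly.
have : ('X + 1 : {poly F}) ^+ (u * q + k) = ('X^q + 1) ^+ u * ('X + 1) ^+ k.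
  by rewrite exprD mulnC exprM exprDn_pchar ?card_pnat // expr1n.
have [v ->] : exists v : {poly F}, ('X^q + 1) ^+ u = 1 + v * 'X^q.
  elim: u => [|u [v IHu]]; first by exists 0; rewrite expr0 mul0r addr0.
  by exists (1 + v * 'X^q + v); rewrite exprS IHu; ring.
move/(congr1 (fun p : {poly F} => p`_k)).
rewrite -polyC1 coef_XaddC polyC1 expr1n mulrDl mul1r coefD mulrAC coefMXn ltkq addr0.
by rewrite -polyC1 coef_XaddC binn expr1n => ->; apply: oner_neq0.
Qed.

End Frobenius.

Lemma horner_map_sum (R S : comNzRingType) (f : {rmorphism R -> S}) (y : S)
    (I : Type) (t : seq I) (G : I -> {poly R}) :
  (map_poly f (\sum_(i <- t) G i)).[y] = \sum_(i <- t) (map_poly f (G i)).[y].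
Proof. by rewrite raddf_sum horner_sum. Qed.

Lemma horner_map_mon (R S : comNzRingType) (f : {rmorphism R -> S}) (y : S) c g a :
  (map_poly f (c%:P * (g%:P * 'X^a))).[y] = f c * (f g * y ^+ a).
Proof.
by rewrite !rmorphM /= !map_polyC map_polyXn !hornerM !hornerC hornerXn.
Qed.

Section Split.
Variables (F : finFieldType) (n : nat).

(** The exponent of x_1^a x^k, where x stands for the remaining variables. *)
Definition mcons (a : nat) (k : 'X_{1..n}) : 'X_{1..n.+1} :=
  [multinom if unlift ord0 i is Some j then k j else a | i < n.+1].

Lemma mcons0 a k : mcons a k ord0 = a.
Proof. by rewrite mnmE unlift_none. Qed.

Lemma mconsS a k j : mcons a k (lift ord0 j) = k j.
Proof. by rewrite mnmE liftK. Qed.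

Lemma mconsP (e : 'X_{1..n.+1}) : exists a k, e = mcons a k.
Proof.
exists (e ord0), [multinom e (lift ord0 j) | j < n]; apply/mnmP => i.
by case: (unliftP ord0 i) => [j|] ->; rewrite ?mcons0 // mconsS mnmE.
Qed.

Lemma mcons_inj a k b l : mcons a k = mcons b l -> a = b /\ k = l.
Proof.
move=> e; split; first by rewrite -(mcons0 a k) e mcons0.
by apply/mnmP => j; rewrite -(mconsS a k) e mconsS.
Qed.

Lemma mdeg_mcons a k : mdeg (mcons a k) = (a + mdeg k)%N.
Proof.
rewrite !mdegE big_ord_recl mcons0; congr (_ + _)%N.
by apply: eq_bigr => j _; rewrite mconsS.
Qed.

Local Notation cst := (polyC \o @mpolyC n F).

Definition cvar (i : 'I_n.+1) : {poly {mpoly F[n]}} :=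
  if unlift ord0 i is Some j then ('X_j)%:P else 'X.

(** The isomorphism with polynomials in the first variable over the polynomials in
    the others; as a ring morphism it determines the action of the group. *)
Definition expand1 (p : {mpoly F[n.+1]}) : {poly {mpoly F[n]}} := mmap cst cvar p.
HB.instance Definition _ := GRing.RMorphism.copy expand1 (mmap cst cvar).

Lemma expand1X a k : expand1 'X_[mcons a k] = ('X_[k])%:P * 'X^a.
Proof.
rewrite /expand1 mmapX /mmap1 big_ord_recl mcons0 {1}/cvar unlift_none mulrC.
congr (_ * _); rewrite mpolyXE_id rmorph_prod; apply: eq_bigr => j _.
by rewrite mconsS /cvar liftK rmorphXn.
Qed.

Lemma expand1Z c p : expand1 (c *: p) = cst c * expand1 p.
Proof. exact: mmapZ. Qed.

Lemma expand1_coef p a k : ((expand1 p)`_a)@_k = p@_(mcons a k).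
Proof.
rewrite [in RHS](mpolyE p) {1}(mpolyE p) !raddf_sum coef_sum raddf_sum.
apply: eq_bigr => e _ /=; have [b [l ->]] := mconsP e.
rewrite expand1Z expand1X mulrA -polyCM coefCM coefXn mul_mpolyC -scalerAl mcoeffZ.
rewrite mcoeffZ mcoeffX; congr (_ * _); case: (eqVneq a b) => [->|nab].
  rewrite mulr1 mcoeffX; congr (_%:R); congr nat_of_bool.
  by apply/eqP/eqP => [->|/mcons_inj[]].
rewrite mulr0 mcoeff0; case: eqP => // /mcons_inj[ba _].
by rewrite ba eqxx in nab.
Qed.

(** The action of [flag_mx c r s] on the variables other than the first, which is
    sent to 'X. *)
Definition shift (r : 'rV[F]_n) (s : 'M[F]_n) (g : {mpoly F[n]}) : {poly {mpoly F[n]}} :=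
  mmap cst (fun j => cst (r 0 j) * 'X + (\sum_i s i j *: 'X_i)%:P) g.
HB.instance Definition _ r s := GRing.RMorphism.copy (shift r s)
  (mmap cst (fun j => cst (r 0 j) * 'X + (\sum_i s i j *: 'X_i)%:P)).

Lemma expand1_varl : expand1 'X_(ord0 : 'I_n.+1) = 'X.
Proof. by rewrite /expand1 mmapX mmap1U /cvar unlift_none. Qed.

Lemma expand1_varr j : expand1 'X_(lift ord0 j) = ('X_j)%:P.
Proof. by rewrite /expand1 mmapX mmap1U /cvar liftK. Qed.

Lemma expand1_flag_mx c r s (B := flag_mx c r s) j :
  expand1 (\sum_i B i j *: 'X_i) =
  if unlift ord0 j is Some j' then cst (r 0 j') * 'X + (\sum_i s i j' *: 'X_i)%:P
  else cst c * 'X.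
Proof.
have e0 : (ord0 : 'I_n.+1) = lshift n (0 : 'I_1) by apply: val_inj.
have B00 : B ord0 ord0 = c by rewrite e0 /B /flag_mx (block_mxEul (c%:M : 'M_1)) mxE eqxx.
have B0S i : B ord0 (lift ord0 i) = r 0 i.
  by rewrite -rshift1 e0 /B /flag_mx (block_mxEur (c%:M : 'M_1)).
have BS0 i : B (lift ord0 i) ord0 = 0.
  by rewrite -rshift1 e0 /B /flag_mx (block_mxEdl (c%:M : 'M_1)) mxE.
have BSS i k : B (lift ord0 i) (lift ord0 k) = s i k.
  by rewrite -!rshift1 /B /flag_mx (block_mxEdr (c%:M : 'M_1)).
rewrite raddf_sum big_ord_recl /= expand1Z expand1_varl.
under eq_bigr do rewrite expand1Z expand1_varr.
case: (unliftP ord0 j) => [j'|] ->; last first.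
  by rewrite B00 big1 ?addr0 // => i _; rewrite BS0 !rmorph0 mul0r.
rewrite B0S; congr (_ + _); rewrite raddf_sum; apply: eq_bigr => i _ /=.
by rewrite BSS -polyCM mul_mpolyC.
Qed.

Lemma expand1_subst c r s p :
  expand1 (gl_subst (flag_mx c r s) p) =
  (map_poly (shift r s) (expand1 p)).[cst c * 'X].
Proof.
rewrite /gl_subst comp_mpolyEX raddf_sum [in RHS](mpolyE p) [expand1 (\sum_(k <- _) _)]raddf_sum.
rewrite (horner_map_sum (shift r s)); apply: eq_bigr => e _ /=.
have [a [k ->]] := mconsP e.
rewrite !expand1Z expand1X (horner_map_mon (shift r s)) comp_mpolyX rmorph_prod.
rewrite big_ord_recl mcons0 rmorphXn /= tnth_mktuple expand1_flag_mx unlift_none.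
rewrite [shift _ _ _%:MP]mmapC; congr (_ * _); rewrite mulrC; congr (_ * _).
rewrite /shift mmapX; apply: eq_bigr => j _.
by rewrite rmorphXn /= tnth_mktuple expand1_flag_mx liftK mconsS.
Qed.

Lemma expand1_subst_coef c r s p N :
  (expand1 (gl_subst (flag_mx c r s) p))`_N =
  \sum_(a < N.+1) c ^+ a *: (shift r s (expand1 p)`_a)`_(N - a).
Proof.
rewrite expand1_subst (horner_coef_wide (n := maxn (size (expand1 p)) N.+1)); last first.
  by rewrite (leq_trans (size_poly _ _)) // leq_maxl.
rewrite coef_sum (big_ord_widen _ (fun a => c ^+ a *: (shift r s (expand1 p)`_a)`_(N - a))
  (leq_maxr (size (expand1 p)) N.+1)) [RHS]big_mkcond.
apply: eq_bigr => a _; rewrite exprMn mulrA coefMXn coef_map /= -rmorphXn /= mulrC coefCM.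
by rewrite -mul_mpolyC rmorphXn /= ltnS; case: ltnP.
Qed.

Lemma shift0 s g : shift 0 s g = (gl_subst s g)%:P.
Proof.
rewrite /gl_subst comp_mpolyEX rmorph_sum /shift /mmap; apply: eq_bigr => k _.
rewrite -mul_mpolyC rmorphM /= comp_mpolyX rmorph_prod; congr (_ * _).
apply: eq_bigr => j _; rewrite tnth_mktuple mxE !rmorph0 mul0r add0r.
by rewrite -rmorphXn.
Qed.

Lemma subst1 p : gl_subst 1%:M p = p :> {mpoly F[n]}.
Proof.
rewrite -[RHS]comp_mpoly_id /gl_subst; congr (_ \mPo _); apply: eq_from_tnth => j.
rewrite !tnth_mktuple (bigD1 j) //= mxE eqxx scale1r big1 ?addr0 // => i ij.
by rewrite mxE (negPf ij) scale0r.
Qed.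

Lemma subst_coef c s p a :
  (expand1 (gl_subst (flag_mx c 0 s) p))`_a =
  c ^+ a *: gl_subst s (expand1 p)`_a.
Proof.
rewrite [LHS]expand1_subst_coef (bigD1 ord_max) //= subnn shift0 coefC eqxx.
rewrite big1 ?addr0 // => b; rewrite -val_eqE /= => nb.
by rewrite shift0 coefC subn_eq0 leqNgt ltn_neqAle nb -ltnS ltn_ord scaler0.
Qed.

Lemma sum_id_mx j : \sum_i (1%:M : 'M[F]_n) i j *: 'X_i = 'X_j :> {mpoly F[n]}.
Proof.
rewrite (bigD1 j) //= mxE eqxx scale1r big1 ?addr0 // => i ij.
by rewrite mxE (negPf ij) scale0r.
Qed.

(** The binomial expansion of the substitution x_j -> x_j + x_1; the coefficients
    of its powers of x_1 are the divided derivatives with respect to x_j. *)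
Lemma shift_delta_coef j (g : {mpoly F[n]}) k e :
  ((shift (delta_mx 0 j) 1%:M g)`_k)@_e =
  g@_(e + U_(j) *+ k) *+ 'C(e j + k, k).
Proof.
pose y := 'X + ('X_j)%:P : {poly {mpoly F[n]}}.
(* The part of the exponent f away from j. *)
pose rest f := [multinom if i == j then 0%N else f i | i < n] : 'X_{1..n}.
have restE f i : rest f i = if i == j then 0%N else f i by exact: mnmE.
have Ej i : cst ((delta_mx 0 j : 'rV[F]_n) 0 i) * 'X + (\sum_l (1%:M : 'M[F]_n) l i *: 'X_l)%:P =
    (if i == j then y else ('X_i)%:P) :> {poly {mpoly F[n]}}.
  rewrite sum_id_mx mxE eqxx /= /y; case: eqP => [->|_].
    by rewrite rmorph1 mul1r.
  by rewrite rmorph0 mul0r add0r.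
have ET f : shift (delta_mx 0 j) 1%:M 'X_[f] = ('X_[rest f])%:P * y ^+ f j.
  rewrite /shift mmapX /mmap1.
  under eq_bigr do rewrite Ej.
  rewrite (bigD1 j) //= eqxx.
  rewrite [LHS]mulrC.
  rewrite [in RHS]mpolyXE_id [in RHS]rmorph_prod [in RHS](bigD1 j) //=.
  rewrite restE eqxx expr0 rmorph1 mul1r.
  congr (_ * _).
  apply: eq_bigr => i ij.
  by rewrite (negPf ij) restE (negPf ij) rmorphXn.
have Ek f : (('X_[rest f])%:P * y ^+ f j)`_k = 'X_[rest f + U_(j) *+ (f j - k)] *+ 'C(f j, k).
  by rewrite coefCM coef_XaddC mpolyXD mpolyXn mulrnAr.
rewrite [in LHS](mpolyE g) [in RHS](mpolyE g).
rewrite [shift _ _ _]raddf_sum coef_sum.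
rewrite [LHS]raddf_sum [in RHS]raddf_sum /= -sumrMnl; apply: eq_bigr => f _.
rewrite -mul_mpolyC rmorphM /= ET [shift _ _ _%:MP]mmapC coefCM Ek !mcoeffCM.
rewrite mcoeffMn -mulrnAr; congr (_ * _); rewrite !mcoeffX -!mulrnA.
case: (ltnP (f j) k) => [lt|le].
  rewrite bin_small // muln0; case: eqP => // ef.
  by move: lt; rewrite ef mnmDE mulmnE mnm1E eqxx mul1n ltnNge leq_addl.
have -> : ((rest f + U_(j) *+ (f j - k))%MM == e) = (f == (e + U_(j) *+ k)%MM).
  apply/eqP/eqP => [<-|ef]; apply/mnmP => i; last first.
    rewrite ef !(mnmDE, mulmnE, mnm1E, restE) eqxx mul1n addnK.
    by case: (eqVneq i j) => [->|_] /=; rewrite ?mul1n ?mul0n ?addn0.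
  rewrite !(mnmDE, mulmnE, mnm1E, restE).
  by case: (eqVneq i j) => [->|_] /=; rewrite ?mul1n ?mul0n ?subnK ?addn0.
case: eqP => [->|_]; last by rewrite !mul0n.
by rewrite mnmDE mulmnE mnm1E eqxx !mul1n.
Qed.

Definition mtail (e : 'X_{1..n.+1}) : 'X_{1..n} := [multinom e (lift ord0 j) | j < n].

(** The coefficient of x_1^a, so the a-th coefficient of [expand1 p]; the explicit
    sum makes its own coefficients those of p ([fcoefE]). *)
Definition fcoef (a : nat) (p : {mpoly F[n.+1]}) : {mpoly F[n]} :=
  \sum_(e <- msupp p | e ord0 == a) p@_e *: 'X_[mtail e].

Lemma fcoefE a p k : (fcoef a p)@_k = p@_(mcons a k).
Proof.
rewrite [in RHS](mpolyE p) /fcoef !raddf_sum big_mkcond; apply: eq_bigr => e _ /=.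
rewrite !mcoeffZ !mcoeffX; have [b [l ->]] := mconsP e; rewrite mcons0.
have -> : mtail (mcons b l) = l by apply/mnmP => i; rewrite mnmE mconsS.
case: (eqVneq b a) => [->|nba].
  congr (_ * _%:R); congr nat_of_bool; apply/eqP/eqP => [->//|/mcons_inj[]//].
case: eqP => [/mcons_inj[ba _]|_]; last by rewrite mulr0.
by rewrite ba eqxx in nba.
Qed.

Lemma fcoef_expand a p : fcoef a p = (expand1 p)`_a.
Proof. by apply/mpolyP => k; rewrite fcoefE expand1_coef. Qed.

Definition shift_coef r s k (g : {mpoly F[n]}) : {mpoly F[n]} := (shift r s g)`_k.

Lemma fcoef_subst_sum c r s N p :
  fcoef N (gl_subst (flag_mx c r s) p) =
  \sum_(a < N.+1) c ^+ a *: shift_coef r s (N - a) (fcoef a p).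
Proof.
rewrite fcoef_expand; apply: (etrans (expand1_subst_coef _ _ _ _ _)).
by apply: eq_bigr => a _; rewrite fcoef_expand.
Qed.

Lemma fcoef_subst c s a p :
  fcoef a (gl_subst (flag_mx c 0 s) p) = c ^+ a *: gl_subst s (fcoef a p).
Proof. by rewrite !fcoef_expand; apply: subst_coef. Qed.

Lemma fcoef_shift i N p e :
  (fcoef N (gl_subst (flag_mx 1 (delta_mx 0 i) 1%:M) p))@_e =
  \sum_(a < N.+1) (fcoef a p)@_(e + U_(i) *+ (N - a)) *+ 'C(e i + (N - a), N - a).
Proof.
rewrite fcoef_subst_sum raddf_sum; apply: eq_bigr => a _ /=.
by rewrite expr1n scale1r; apply: shift_delta_coef.
Qed.

End Split.

Section FirstCoefficient.
Variables (F : finFieldType) (n : nat).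

Lemma fcoef_is_linear a : linear (@fcoef F n a).
Proof.
move=> c p r; apply/mpolyP => k.
by rewrite mcoeffD mcoeffZ !fcoefE mcoeffD mcoeffZ.
Qed.

Lemma fcoefB a (p r : {mpoly F[n.+1]}) : fcoef a (p - r) = fcoef a p - fcoef a r.
Proof. by apply/mpolyP => k; rewrite mcoeffB !fcoefE mcoeffB. Qed.

End FirstCoefficient.

(** * Leading coefficients of invariants *)

Section FrobX.
Variables (F : finFieldType) (n : nat).
Local Notation q := #|F|.

Lemma card_field_gt0 : (0 < q)%N. Proof. exact: ltnW (card_finNzRing_gt1 F). Qed.

Definition frobX (h : {mpoly F[n]}) : {mpoly F[n]} := h \mPo [tuple 'X_i ^+ q | i < n].

Lemma frobXE h : frobX h = \sum_(k <- msupp h) h@_k *: 'X_[k *+ q].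
Proof.
rewrite /frobX comp_mpolyEX; apply: eq_bigr => k _; congr (_ *: _).
rewrite comp_mpolyX [RHS]mpolyXE_id; apply: eq_bigr => i _.
by rewrite tnth_mktuple mulmnE mulnC exprM.
Qed.

Lemma mulm_card_inj (k l : 'X_{1..n}) : (k *+ q = l *+ q)%MM -> k = l.
Proof.
move=> e; apply/mnmP => i; apply/eqP; rewrite -(eqn_pmul2r card_field_gt0).
by rewrite -!mulmnE e.
Qed.

Lemma frobX_coef h k : (frobX h)@_(k *+ q) = h@_k.
Proof.
rewrite frobXE [in RHS](mpolyE h) !raddf_sum; apply: eq_bigr => l _ /=.
rewrite !mcoeffZ !mcoeffX; congr (_ * _%:R); congr nat_of_bool.
by apply/eqP/eqP => [/mulm_card_inj|->].
Qed.

Lemma frobX_coef0 h e : (forall k, e <> (k *+ q)%MM) -> (frobX h)@_e = 0.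
Proof.
move=> ne; rewrite frobXE raddf_sum big1 // => k _ /=.
by rewrite mcoeffZ mcoeffX; case: eqP => [ek|_]; rewrite ?mulr0 //; case: (ne k).
Qed.

(** Divide all exponents by q: a bounded exponent for m+1 that is a multiple of q
    corresponds to a bounded exponent for m. *)
Lemma frobX_ideal m h : (frobX h \in @frob_ideal F m.+1 n) = (h \in @frob_ideal F m n).
Proof.
apply/frob_idealPcoef/frob_idealPcoef => h0 k ltk.
  rewrite -frobX_coef; apply: h0 => i.
  by rewrite mulmnE expnSr ltn_pmul2r ?card_field_gt0.
have [/forallP dv|ndv] := boolP [forall i, q %| k i]%N; last first.
  apply: frobX_coef0 => l kl; case/negP: ndv; apply/forallP => i.
  by rewrite kl mulmnE dvdn_mull.
have [l kl] : exists l, k = (l *+ q)%MM.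
  exists [multinom (k i %/ q)%N | i < n].
  by apply/mnmP => i; rewrite mulmnE mnmE divnK.
rewrite kl frobX_coef; apply: h0 => i; have := ltk i.
by rewrite kl mulmnE expnSr ltn_pmul2r ?card_field_gt0.
Qed.

(** Entries of s lie in F and are fixed by the q-th power map, which is additive;
    hence linear substitutions commute with x_i -> x_i^q. *)
Lemma frobX_subst s h : frobX (gl_subst s h) = gl_subst s (frobX h).
Proof.
rewrite {1}/gl_subst comp_mpolyEX {1}/frobX raddf_sum {1}frobXE.
rewrite /gl_subst [RHS]raddf_sum; apply: eq_bigr => k _ /=.
rewrite !comp_mpolyZ; congr (_ *: _); rewrite !comp_mpolyX rmorph_prod.
apply: eq_bigr => j _; rewrite tnth_mktuple rmorphXn /= raddf_sum mulmnE mulnC exprM.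
congr (_ ^+ _); rewrite -[q in RHS]expn1 frobenius_sum expn1; apply: eq_bigr => i _ /=.
by rewrite comp_mpolyZ comp_mpolyXU -tnth_nth tnth_mktuple exprZn expf_card.
Qed.

End FrobX.

Section Leading.
Variables (F : finFieldType) (m n : nat).
Local Notation q := #|F|.
Local Notation Q := (q ^ m)%N.

Definition bounded N (p : {mpoly F[N]}) := forall e i, p@_e != 0 -> (e i < Q)%N.

(** Invariance of the class of p in the truncated algebra, stated for polynomials. *)
Definition invmod N (p : {mpoly F[N]}) :=
  forall s, s \in @borel F N -> gl_subst s p - p \in @frob_ideal F m N.

Lemma bounded_ideal0 N (p : {mpoly F[N]}) : bounded p -> p \in @frob_ideal F m N -> p = 0.
Proof.
move=> bp Ip; apply/mpolyP => e; rewrite mcoeff0; apply/eqP; apply: contraT => pe.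
by move: (pe); rewrite (frob_ideal_coef Ip (fun i => bp e i pe)) eqxx.
Qed.

Definition mfilter N (P : pred 'X_{1..N}) (p : {mpoly F[N]}) : {mpoly F[N]} :=
  \sum_(k <- msupp p | P k) p@_k *: 'X_[k].

Lemma mfilterE N (P : pred 'X_{1..N}) p e : (mfilter P p)@_e = if P e then p@_e else 0.
Proof.
rewrite [in RHS](mpolyE p) /mfilter !raddf_sum big_mkcond /=.
have -> : (if P e then \sum_(k <- msupp p) (p@_k *: 'X_[k])@_e else 0)
   = \sum_(k <- msupp p) if P e then (p@_k *: 'X_[k])@_e else 0.
  by case: (P e) => //; rewrite big1.
apply: eq_bigr => k _; rewrite mcoeffZ mcoeffX.
by case: (eqVneq k e) => [->|_]; rewrite ?mulr0 ?if_same.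
Qed.

(** Reduced representatives.  Working with them turns congruences between leading
    coefficients into equalities, by [bounded_ideal0]. *)
Lemma bounded_tpi N (p : {mpoly F[N]}) : exists r, [/\ bounded r, tpi m p = tpi m r
  & forall d, p \is d.-homog -> r \is d.-homog].
Proof.
exists (mfilter (fun k : 'X_{1..N} => [forall i, k i < Q]%N) p); split.
- by move=> e i; rewrite mfilterE; case: ifP => [/forallP/(_ i)|]; rewrite ?eqxx.
- apply/eqP; rewrite tpi_eq; apply/frob_idealPcoef => e lte.
  rewrite mcoeffB mfilterE; case: ifP; rewrite ?subrr // => /negP[].
  exact/forallP.
move=> d hp; apply/dhomogP => e; rewrite mcoeff_msupp mfilterE; case: ifP; rewrite ?eqxx // => _.
by rewrite -mcoeff_msupp; move/dhomogP: hp; apply.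
Qed.

Lemma bounded_repr N d (u : trunc_poly F m N) : u \in trunc_degree F m N d ->
  exists p, [/\ bounded p, p \is d.-homog & u = tpi m p].
Proof.
case/trunc_degreeP => p hp ->; have [r [br -> hr]] := bounded_tpi p.
by exists r; split=> //; apply: hr.
Qed.

Lemma invmodP N (p : {mpoly F[N]}) :
  tpi m p \in borel_invariants F m N <-> invmod p.
Proof.
split=> [/borel_invariantsP ip s bs|ip].
  by rewrite -tpi_eq -trunc_act_pi ip.
by apply/borel_invariantsP => s bs; rewrite trunc_act_pi; apply/eqP; rewrite tpi_eq ip.
Qed.

Lemma fcoef_ideal (p : {mpoly F[n.+1]}) a : p \in @frob_ideal F m n.+1 -> (a < Q)%N ->
  fcoef a p \in @frob_ideal F m n.
Proof.
move=> Ip lta; apply/frob_idealPcoef => k ltk; rewrite fcoefE.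
apply: (frob_ideal_coef Ip) => i.
by case: (unliftP ord0 i) => [j|] ->; rewrite ?mcons0 ?mconsS.
Qed.

Lemma bounded_fcoef (p : {mpoly F[n.+1]}) a : bounded p -> bounded (fcoef a p).
Proof. by move=> bp k i; rewrite fcoefE -(mconsS a) => /bp. Qed.

(** Otherwise all q-1 nonzero elements of F would be roots of X^r - 1, where r > 0
    is the remainder of a modulo q-1. *)
Lemma exists_expf_neq1 a : ~~ (q.-1 %| a)%N -> exists2 c : F, c != 0 & c ^+ a != 1.
Proof.
have q1 := card_finNzRing_gt1 F.
move=> na; pose r := (a %% q.-1)%N.
have r0 : (0 < r)%N by rewrite lt0n.
have rq : (r < q.-1)%N by rewrite ltn_mod; case: q q1 => [|[]].
have cr (c : F) : c != 0 -> c ^+ a = c ^+ r.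
  move=> c0; have c1 : c ^+ q.-1 = 1.
    apply: (mulfI c0); rewrite -exprS prednK ?card_field_gt0 // mulr1.
    exact: expf_card.
  by rewrite (divn_eq a q.-1) exprD mulnC exprM c1 expr1n mul1r.
pose C := [set c : F | c != 0].
have cC : #|C| = q.-1.
  by have := cardsC1 (0 : F); rewrite -(eq_card (A := C)) // => c; rewrite !inE.
apply/exists_inP; apply: contraT; rewrite negb_exists_in => /forall_inP h.
have := max_poly_roots (p := 'X^r - 1) (rs := enum C).
rewrite -size_poly_gt0 -polyC1 size_XnsubC // => /(_ isT).
rewrite -cardE cC ltnS leqNgt rq /= => -> //; last exact: enum_uniq.
apply/allP => c; rewrite mem_enum inE => c0.
rewrite rootE !hornerE subr_eq0 -cr //.
by have := h c c0; rewrite negbK.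
Qed.

Section Fixed.
Variable p : {mpoly F[n.+1]}.
Hypotheses (bp : bounded p) (ip : invmod p).

Lemma lead_invariant a : (a < Q)%N -> invmod (fcoef a p).
Proof.
move=> lta s bs; have := fcoef_ideal (ip (s := flag_mx 1 0 s) _) lta.
rewrite borel_flag_mx oner_neq0 bs => /(_ isT).
by rewrite fcoefB fcoef_subst expr1n scale1r.
Qed.

(** Scaling x_1 by c multiplies the coefficient of x_1^a by c^a. *)
Lemma lead_torus a : (a < Q)%N -> ~~ (q.-1 %| a)%N -> fcoef a p = 0.
Proof.
move=> lta /exists_expf_neq1[c c0 ca].
apply: bounded_ideal0; first exact: bounded_fcoef.
have := fcoef_ideal (ip (s := flag_mx c 0 1%:M) _) lta.
have b1 : 1%:M \in @borel F n.
  by apply/borelP; split=> [|i j ltji]; rewrite ?unitmx1 // mxE -val_eqE gtn_eqF.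
rewrite borel_flag_mx c0 b1 => /(_ isT).
rewrite fcoefB fcoef_subst subst1 -{2}[fcoef a p]scale1r -scalerBl.
move=> h; apply/frob_idealPcoef => k ltk; move/eqP: (frob_ideal_coef h ltk).
by rewrite mcoeffZ mulf_eq0 subr_eq0 (negPf ca) => /eqP.
Qed.

Variable a : nat.
Hypotheses (lta : (a < Q.-1)%N) (before : forall b, (b < a)%N -> fcoef b p = 0).

(** Suppose that e_i has remainder k > 0 modulo q, and compare coefficients of
    x_1^(a+k) in p and in its image under x_i -> x_i + x_1.  Lower powers x_1^b with
    b < a vanish by hypothesis, those with a < b < a+k by [lead_torus], and
    b = a+k cancels.  What remains is a binomial coefficient, nonzero by
    [binomial_card], times the coefficient at e. *)
Lemma lead_exponent e i : (fcoef a p)@_e != 0 -> (q %| e i)%N.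
Proof.
move=> nz; have q1 := card_finNzRing_gt1 F.
have [da|nda] := boolP (q.-1 %| a)%N; last first.
  by rewrite lead_torus ?mcoeff0 ?eqxx // in nz; rewrite (leq_trans lta) ?leq_pred.
pose k := (e i %% q)%N; rewrite /dvdn -/k; apply: contraT => k0.
have ltkq : (k < q)%N by rewrite ltn_mod card_field_gt0.
(* As a and Q-1 are multiples of q-1, even a + (q-1) is at most Q-1: the power
   x_1^(a+k) survives truncation. *)
have akQ : (a + k < Q)%N.
  have : (a + q.-1 <= Q.-1)%N.
    move: lta; rewrite -(qintE m (card_field_gt0 F)); case/dvdnP: da => x ->.
    by rewrite -mulSnr ltn_pmul2r ?leq_pmul2r // -subn1 subn_gt0.
  have := card_field_gt0 F; have : (0 < Q)%N by rewrite expn_gt0 card_field_gt0.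
  by move: ltkq; lia.
pose e' := (e - U_(i) *+ k)%MM.
have ei' : (e' i = e i %/ q * q)%N.
  by rewrite mnmBE mulmnE mnm1E eqxx mul1n {1}(divn_eq (e i) q) addnK.
have ee : e = (e' + U_(i) *+ k)%MM.
  rewrite submK //; apply/mnm_lepP => j; rewrite mulmnE mnm1E.
  by case: eqP => [<-|_]; rewrite ?mul1n ?mul0n // leq_mod.
have := fcoef_ideal (ip (s := flag_mx 1 (delta_mx 0 i) 1%:M) _) akQ.
have b1 : 1%:M \in @borel F n.
  by apply/borelP; split=> [|i' j ltji]; rewrite ?unitmx1 // mxE -val_eqE gtn_eqF.
rewrite borel_flag_mx oner_neq0 b1 => /(_ isT).
move=> /frob_ideal_coef h; move: (nz); rewrite {1}ee.
have lte' j : (e' j < Q)%N.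
  have lte : (e j < Q)%N by move: nz; apply: bounded_fcoef.
  by apply: leq_ltn_trans lte; rewrite mnmBE leq_subr.
have := h e' lte'; rewrite fcoefB mcoeffB fcoef_shift.
rewrite big_ord_recr /= subnn bin0 mulm0n addm0 mulr1n addrK.
have ltak : (a < a + k)%N by rewrite -addn1 leq_add2l lt0n.
rewrite (bigD1 (Ordinal ltak)) //= addKn big1 ?addr0; last first.
  move=> b; rewrite -val_eqE /= => nba; rewrite [fcoef b p](_ : _ = 0).
    by rewrite mcoeff0 mul0rn.
  case: (ltnP b a) => [/before //|leab]; apply: lead_torus.
    by apply: ltn_trans akQ.
  apply/negP => db; have : (q.-1 %| b - a)%N by rewrite dvdn_sub.
  have ltab : (a < b)%N by rewrite ltn_neqAle eq_sym nba.
  move/dvdn_leq; rewrite subn_gt0 => /(_ ltab).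
  by move: ltkq ltab (ltn_ord b); clear; lia.
rewrite ei' -mulr_natr => /eqP; rewrite mulf_eq0.
by rewrite (negPf (binomial_card _ ltkq)) orbF => ->.
Qed.

End Fixed.
End Leading.

(** * The recursion for dimensions *)

Section Filtration.
Variables (K : fieldType) (aT rT : vectType K) (f : nat -> 'Hom(aT, rT)) (U : {vspace aT}).

Fixpoint filtration (a : nat) : {vspace aT} :=
  if a is b.+1 then (filtration b :&: lker (f b))%VS else U.

Lemma filtrationP a u :
  reflect (u \in U /\ forall b, (b < a)%N -> f b u = 0) (u \in filtration a).
Proof.
elim: a => [|a IHa] /=; first by apply: (iffP idP) => [|[]].
rewrite memv_cap memv_ker; apply: (iffP andP) => [[/IHa[uU h] /eqP fa]|[uU h]].
  by split=> // b; rewrite ltnS leq_eqVlt => /orP[/eqP->|/h].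
by split; [apply/IHa; split=> // b /ltnW/h | rewrite h].
Qed.

Lemma dim_filtration N :
  \dim U = (\sum_(a < N) \dim (f a @: filtration a) + \dim (filtration N))%N.
Proof.
elim: N => [|N IHN]; first by rewrite big_ord0.
by rewrite IHN big_ord_recr /= -(limg_ker_dim (f N) (filtration N)); lia.
Qed.

End Filtration.

Section Maps.
Variables (F : finFieldType) (m n : nat).
Local Notation q := #|F|.
Local Notation Q := (q ^ m)%N.

(** The guard keeps [lead] linear for all a: from x_1^Q on, coefficients are not
    well defined on the quotient. *)
Definition lead a (u : trunc_poly F m n.+1) : trunc_poly F m n :=
  if (a < Q)%N then tpi m (fcoef a (trepr u)) else 0.

Lemma lead_pi a p : (a < Q)%N -> lead a (tpi m p) = tpi m (fcoef a p).
Proof.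
move=> lta; rewrite /lead lta; apply/eqP; rewrite tpi_eq -fcoefB.
by apply: fcoef_ideal => //; rewrite -tpi_eq treprK.
Qed.

Fact lead_is_linear a : linear (lead a).
Proof.
move=> c u v; case lta: (a < Q)%N; last by rewrite /lead lta scaler0 addr0.
rewrite -[u]treprK -[v]treprK -linearP !lead_pi //.
by rewrite fcoef_is_linear linearP.
Qed.

HB.instance Definition _ a :=
  GRing.isLinear.Build F (trunc_poly F m n.+1) (trunc_poly F m n) _ (lead a)
    (lead_is_linear a).

Definition frobT (u : trunc_poly F m n) : trunc_poly F m.+1 n :=
  tpi m.+1 (frobX (trepr u)).

Fact frobX_is_linear : linear (@frobX F n).
Proof. by move=> c p r; rewrite /frobX linearP. Qed.

Lemma frobT_pi h : frobT (tpi m h) = tpi m.+1 (frobX h).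
Proof.
apply/eqP; rewrite tpi_eq -scaleN1r addrC -frobX_is_linear frobX_ideal.
by rewrite scaleN1r addrC -tpi_eq treprK.
Qed.

Fact frobT_is_linear : linear frobT.
Proof.
move=> c u v; rewrite -[u]treprK -[v]treprK -linearP !frobT_pi.
by rewrite frobX_is_linear linearP.
Qed.

HB.instance Definition _ :=
  GRing.isLinear.Build F (trunc_poly F m n) (trunc_poly F m.+1 n) _ frobT
    frobT_is_linear.

End Maps.

Section UpperBound.
Variable F : finFieldType.
Local Notation q := #|F|.

Definition hdim m n d := \dim (borel_invariants F m n :&: trunc_degree F m n d).

Definition leading m n d :=
  filtration (fun a => linfun (@lead F m n a))
    (borel_invariants F m n.+1 :&: trunc_degree F m n.+1 d).

Lemma leadingP m n d a u : u \in leading m n d a -> (a <= q ^ m)%N ->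
  exists p, [/\ bounded m p, invmod m p, p \is d.-homog, u = tpi m p
   & forall b, (b < a)%N -> fcoef b p = 0].
Proof.
case/filtrationP; rewrite memv_cap => /andP[iu /bounded_repr[p [bp hp eu]]] before leaQ.
exists p; split=> // [|b ltba]; first by apply/invmodP; rewrite -eu.
apply: (bounded_ideal0 (bounded_fcoef bp (a := b))).
have := before b ltba; rewrite lfunE /= eu lead_pi; last exact: leq_trans leaQ.
by move/eqP; rewrite tpi_eq0.
Qed.

Lemma leading_last m n d : leading m n d (q ^ m) = 0%VS.
Proof.
apply/eqP; rewrite -subv0; apply/subvP => u /leadingP[//|p [bp _ _ -> p0]].
rewrite memv0; suff -> : p = 0 by rewrite raddf0.
apply/mpolyP => e; rewrite mcoeff0; apply/eqP; apply: contraT => nz.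
have [a [k ek]] := mconsP e; have lta : (a < q ^ m)%N.
  by have := bp e ord0 nz; rewrite ek mcons0.
by rewrite ek -fcoefE p0 // mcoeff0 eqxx in nz.
Qed.

Lemma fcoef_homog n a d (p : {mpoly F[n.+1]}) : p \is d.-homog -> (a <= d)%N ->
  fcoef a p \is (d - a).-homog.
Proof.
move/dhomogP=> hp led; apply/dhomogP => k; rewrite mcoeff_msupp fcoefE -mcoeff_msupp.
by move/hp; rewrite /= mdeg_mcons => <-; rewrite addKn.
Qed.

Lemma fcoef_homog0 n a d (p : {mpoly F[n.+1]}) : p \is d.-homog -> (d < a)%N ->
  fcoef a p = 0.
Proof.
move/dhomogP=> hp ltda; apply/mpolyP => k; rewrite mcoeff0 fcoefE; apply/eqP.
apply: contraTT ltda; rewrite -mcoeff_msupp => /hp /=; rewrite mdeg_mcons => <-.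
by rewrite -leqNgt leq_addr.
Qed.

(** The torus fixes x_1^(q^m-1) and x_1 annihilates it, so invariance under the
    smaller Borel group is the only condition on the leading coefficient. *)
Lemma dim_lead_top m n d (a := (q ^ m).-1) :
  (\dim (linfun (@lead F m n a) @: leading m n d a) <=
    if (a <= d)%N then hdim m n (d - a) else 0)%N.
Proof.
have Q0 : (0 < q ^ m)%N by rewrite expn_gt0 card_field_gt0.
have ltaQ : (a < q ^ m)%N by rewrite ltn_predL.
have memP v : v \in (linfun (@lead F m n a) @: leading m n d a)%VS ->
    exists p, [/\ p \is d.-homog, invmod m (fcoef a p) & v = tpi m (fcoef a p)].
  case/memv_imgP=> u /leadingP/(_ (leq_pred _))[p [bp ip hp -> p0]] ->.
  exists p; split=> //; first exact: lead_invariant.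
  by rewrite lfunE /= lead_pi.
case: (leqP a d) => [led|ltd].
  apply: dimvS; apply/subvP => v /memP[p [hp ip ->]]; rewrite memv_cap.
  apply/andP; split; first exact/invmodP.
  by apply/trunc_degreeP; exists (fcoef a p) => //; apply: fcoef_homog.
rewrite leqn0 dimv_eq0 -subv0; apply/subvP => v /memP[p [hp ip ->]].
by rewrite (fcoef_homog0 hp) // raddf0 mem0v.
Qed.

Definition unfrobX n (g : {mpoly F[n]}) : {mpoly F[n]} :=
  \sum_(e <- msupp g) g@_e *: 'X_[[multinom (e i %/ q)%N | i < n]].

Lemma unfrobXK n (g : {mpoly F[n]}) :
  (forall e i, g@_e != 0 -> (q %| e i)%N) -> frobX (unfrobX g) = g.
Proof.
move=> dg; rewrite [RHS]mpolyE /unfrobX /frobX raddf_sum !big_seq.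
apply: eq_bigr => e; rewrite mcoeff_msupp => nz.
rewrite /= comp_mpolyZ comp_mpolyX mpolyXE_id; congr (_ *: _).
apply: eq_bigr => i _; rewrite tnth_mktuple mnmE -exprM mulnC divnK //.
exact: dg nz.
Qed.

(** The leading coefficient is h(x_2^q, ..., x_n^q) by [lead_exponent], and h is
    invariant because x_i -> x_i^q commutes with the group. *)
Lemma dim_lead_low m n d a : (a < (q ^ m.+1).-1)%N ->
  (\dim (linfun (@lead F m.+1 n a) @: leading m.+1 n d a) <=
    if [&& q.-1 %| a, a <= d & q %| d - a] then hdim m n ((d - a) %/ q) else 0)%N.
Proof.
move=> lta; have ltaQ : (a < q ^ m.+1)%N by rewrite (leq_trans lta) // leq_pred.
have memP v : v \in (linfun (@lead F m.+1 n a) @: leading m.+1 n d a)%VS ->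
    exists p, [/\ bounded m.+1 p, invmod m.+1 p, p \is d.-homog,
     v = tpi m.+1 (fcoef a p) & forall b, (b < a)%N -> fcoef b p = 0].
  case/memv_imgP=> u /leadingP/(_ (ltnW ltaQ))[p [bp ip hp -> p0]] ->.
  by exists p; split=> //; rewrite lfunE /= lead_pi.
case: ifP => [/and3P[da led dq]|ndiv].
  apply: leq_trans (_ : \dim (linfun (@frobT F m n) @:
     (borel_invariants F m n :&: trunc_degree F m n ((d - a) %/ q))) <= _)%N; last first.
    by rewrite -[leqRHS](limg_ker_dim (linfun (@frobT F m n))) leq_addl.
  apply: dimvS; apply/subvP => v /memP[p [bp ip hp -> p0]].
  have := unfrobXK (lead_exponent bp ip lta p0); set h := unfrobX _ => fh.
  apply/memv_imgP; exists (tpi m h); last by rewrite lfunE /= frobT_pi fh.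
  rewrite memv_cap; apply/andP; split.
    apply/invmodP => s bs; rewrite -frobX_ideal -scaleN1r addrC.
    by rewrite frobX_is_linear scaleN1r addrC frobX_subst fh lead_invariant.
  apply/trunc_degreeP; exists h => //; apply/dhomogP => k.
  rewrite mcoeff_msupp -frobX_coef fh -mcoeff_msupp.
  move/dhomogP: (fcoef_homog hp led) => hf /hf /=; rewrite mdegMn => <-.
  by rewrite mulnK // card_field_gt0.
rewrite leqn0 dimv_eq0 -subv0; apply/subvP => v /memP[p [bp ip hp -> p0]].
suff -> : fcoef a p = 0 by rewrite raddf0 mem0v.
case da: (q.-1 %| a)%N; last by apply: (lead_torus bp ip) => //; rewrite da.
case: (leqP a d) => [led|]; last exact: fcoef_homog0.
apply/mpolyP => e; rewrite mcoeff0; apply/eqP; apply: contraFT ndiv => nz.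
rewrite da led /=; move/dhomogP: (fcoef_homog hp led) => hf.
rewrite -(hf e) ?mcoeff_msupp //= mdegE; apply: dvdn_sum => i _.
exact: (lead_exponent bp ip lta p0).
Qed.

Lemma sum_multiples N k (s : nat -> nat) : (0 < k)%N ->
  (\sum_(a < N * k) (if k %| a then s a else 0) = \sum_(i < N) s (i * k))%N.
Proof.
move=> k0; elim: N => [|N IHN]; first by rewrite mul0n !big_ord0.
rewrite big_ord_recr /= -IHN mulSnr big_split_ord /=; congr (_ + _)%N.
case: k k0 {IHN} => // k _; rewrite big_ord_recl /= addn0 dvdn_mull // big1 ?addn0 //.
move=> i _; rewrite dvdn_addr ?dvdn_mull // /bump /= add1n.
by rewrite gtnNdvd // ltnS.
Qed.

Lemma sum_pred N (s : nat -> nat) : (0 < N)%N ->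
  (\sum_(a < N) s a = s N.-1 + \sum_(a < N.-1) s a)%N.
Proof. by case: N => // N _; rewrite big_ord_recr addnC. Qed.

(** The orders a below q^m-1 that contribute are a = i(q-1), and there are
    (q^m-1)/(q-1) of them by [qintE]. *)
Lemma hdim_recursion m n d :
  (hdim m n.+1 d <= (if (q ^ m).-1 <= d then hdim m n (d - (q ^ m).-1) else 0) +
   \sum_(i < qint q m) (if (i * q.-1 <= d) && (q %| d - i * q.-1)
       then hdim m.-1 n ((d - i * q.-1) %/ q) else 0))%N.
Proof.
have Q0 : (0 < q ^ m)%N by rewrite expn_gt0 card_field_gt0.
rewrite /hdim (dim_filtration (fun a => linfun (@lead F m n a)) _ (q ^ m)).
rewrite -/(leading _ _ _) leading_last dimv0 addn0.
rewrite (sum_pred (fun a => \dim (linfun (@lead F m n a) @: leading m n d a))) //.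
rewrite leq_add ?dim_lead_top //.
case: m Q0 => [|m] Q0; first by rewrite expn0 big_ord0.
have q1 : (0 < q.-1)%N by rewrite -subn1 subn_gt0 card_finNzRing_gt1.
pose s a := if (a <= d)%N && (q %| d - a)%N then hdim m n ((d - a) %/ q) else 0%N.
rewrite -(sum_multiples _ s) // (qintE _ (card_field_gt0 F)).
apply: leq_sum => a _; apply: leq_trans (dim_lead_low _ _ (ltn_ord a)) _.
by rewrite /s; case: (q.-1 %| a)%N.
Qed.

(** For m = 0 the second summand vanishes, as [qint q 0] = 0. *)
Fixpoint hilb (m n : nat) : {poly rat} :=
  if n is n'.+1 then
    'X^((q ^ m).-1) * hilb m n' +
    (\sum_(i < qint q m) 'X^(i * q.-1)) * (hilb m.-1 n' \Po 'X^q)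
  else 1.

Lemma hilb_horner1 m n : (hilb m n).[1] = (norbits q m n)%:R.
Proof.
elim: n m => [|n IHn] m /=; first by rewrite hornerC.
rewrite hornerD !hornerM horner_comp !hornerXn !expr1n !IHn mul1r natrD natrM.
congr (_ + _ * _); rewrite horner_sum.
by under eq_bigr do rewrite hornerXn expr1n; rewrite sumr_const card_ord.
Qed.

Lemma hdim_le_hilb m n d : (hdim m n d)%:R <= (hilb m n)`_d.
Proof.
elim: n m d => [|n IHn] m d /=.
  rewrite coefC; case: d => [|d] /=.
    rewrite -[leRHS]/(1%:R) ler_nat /hdim; apply: leq_trans (dimvS (subvf _)) _.
    rewrite dimvf; apply: (leq_trans (n := #|{: {ffun 'I_0 -> 'I_(q ^ m)}}|)) => //.
    by rewrite card_ffun !card_ord expn0.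
  by rewrite /hdim trunc_degree_eq0 ?mul0n // capv0 dimv0.
have q0 := card_field_gt0 F.
apply: le_trans (_ : ((if ((q ^ m).-1 <= d)%N then hdim m n (d - (q ^ m).-1) else 0%N) +
   \sum_(i < qint q m) (if (i * q.-1 <= d)%N && (q %| d - i * q.-1)%N
       then hdim m.-1 n ((d - i * q.-1) %/ q) else 0%N))%:R <= _).
  by rewrite ler_nat hdim_recursion.
rewrite natrD coefD lerD //.
  rewrite coefXnM; case: (leqP (q ^ m).-1 d) => _ //=.
rewrite natr_sum mulr_suml coef_sum; apply: ler_sum => i _.
rewrite coefXnM coef_comp_poly_Xn //; case: (leqP (i * q.-1)%N d) => _ //=.
by case: ifP.
Qed.

Lemma subst_homog n d (s : 'M[F]_n) p : p \is d.-homog -> gl_subst s p \is d.-homog.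
Proof.
move/dhomogP=> hp; rewrite /gl_subst comp_mpolyEX big_seq.
apply: rpred_sum => k kp; apply: rpredZ; rewrite comp_mpolyX.
have <- : mdeg k = d := hp k kp; rewrite mdegE.
elim/big_rec2: _ => [|i e r _ hr]; first exact: dhomog1.
apply: dhomogM => //; rewrite tnth_mktuple -{2}[k i]mul1n; apply: dhomogMn.
by apply: rpred_sum => j _; apply: rpredZ; rewrite dhomogX /= mdeg1.
Qed.

Definition component n d (p : {mpoly F[n]}) := mfilter (fun k => mdeg k == d) p.

Lemma component_homog n d (p : {mpoly F[n]}) : component d p \is d.-homog.
Proof.
apply/dhomogP => k; rewrite mcoeff_msupp mfilterE.
by case: (eqVneq (mdeg k) d) => [//|]; rewrite eqxx.
Qed.

Lemma sum_component m n N (p : {mpoly F[n]}) : bounded m p -> (n * q ^ m < N)%N ->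
  p = \sum_(d < N) component d p.
Proof.
move=> bp ltN; apply/mpolyP => e; rewrite raddf_sum /=.
have [ltd|led] := ltnP (mdeg e) N.
  rewrite (bigD1 (Ordinal ltd)) //= mfilterE eqxx big1 ?addr0 // => d.
  by rewrite mfilterE -val_eqE /= eq_sym => /negPf->.
have -> : p@_e = 0.
  apply/eqP; apply: contraTT led => nz; rewrite -ltnNge (leq_ltn_trans _ ltN) //.
  rewrite mdegE -[n in leqRHS]card_ord -sum_nat_const.
  by apply: leq_sum => i _; apply/ltnW/bp.
rewrite big1 // => d _; rewrite mfilterE; case: eqP => // de.
by have := ltn_ord d; rewrite -de ltnNge led.
Qed.

(** The action preserves degrees, and the ideal is spanned by monomials, so
    invariance can be checked degree by degree. *)
Lemma component_invmod m n d (p : {mpoly F[n]}) :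
  bounded m p -> invmod m p -> invmod m (component d p).
Proof.
pose N := (n * q ^ m).+1; have ltN : (n * q ^ m < N)%N by [].
move=> bp ip s bs; apply/frob_idealPcoef => k ltk.
have hd d' : gl_subst s (component d' p) - component d' p \is d'.-homog.
  by rewrite rpredB ?subst_homog ?component_homog.
have [kd|nkd] := eqVneq (mdeg k) d; last exact: dhomog_nemf_coeff (hd d) nkd.
have ltd : (d < N)%N.
  rewrite -kd (leq_ltn_trans _ ltN) // mdegE -[n in leqRHS]card_ord -sum_nat_const.
  by apply: leq_sum => i _; apply/ltnW/ltk.
have := frob_ideal_coef (ip s bs) ltk.
rewrite {1 2}(sum_component bp ltN) /gl_subst [X in X - _]raddf_sum -sumrB raddf_sum.
rewrite (bigD1 (Ordinal ltd)) //= big1 ?addr0 // => d'; rewrite -val_eqE /= => nd.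
by apply: (dhomog_nemf_coeff (hd d')); rewrite /= kd eq_sym.
Qed.

Lemma sum_hdim m n N : (n * q ^ m < N)%N ->
  (norbits q m n <= \sum_(d < N) hdim m n d)%N.
Proof.
move=> ltN; apply: leq_trans (dim_borel_invariants F m n) _.
apply: leq_trans (dimv_leq_sum _ _ _); apply: dimvS; apply/subvP => u iu.
have [p [bp eu _]] := bounded_tpi m (trepr u); rewrite treprK in eu.
have ip : invmod m p by apply/invmodP; rewrite -eu.
rewrite eu (sum_component bp ltN) raddf_sum; apply: memv_sumr => d _ /=.
rewrite memv_cap; apply/andP; split.
  by apply/invmodP; apply: component_invmod bp ip.
by apply/trunc_degreeP; exists (component d p) => //; apply: component_homog.
Qed.

(** The differences between the coefficients and the dimensions are nonnegative by
    [hdim_le_hilb], and their sum is nonpositive by the orbit count. *)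
Lemma hilbert_seriesE m n : hilbert_series F m n = hilb m n.
Proof.
pose N := maxn (n * q ^ m).+1 (size (hilb m n)).
have small d : (N <= d)%N -> hdim m n d = 0%N /\ (hilb m n)`_d = 0.
  rewrite geq_max => /andP[ltd sd]; split; last by rewrite nth_default.
  by rewrite /hdim trunc_degree_eq0 // capv0 dimv0.
have tot : \sum_(d < N) ((hilb m n)`_d - (hdim m n d)%:R) <= 0.
  rewrite sumrB subr_le0 -natr_sum.
  have -> : \sum_(d < N) (hilb m n)`_d = (hilb m n).[1].
    rewrite (horner_coef_wide _ (leq_maxr (n * q ^ m).+1 _)).
    by apply: eq_bigr => d _; rewrite expr1n mulr1.
  by rewrite hilb_horner1 ler_nat sum_hdim // leq_maxl.
have pos (d : 'I_N) : true -> 0 <= (hilb m n)`_d - (hdim m n d)%:R.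
  by rewrite subr_ge0 hdim_le_hilb.
have tot0 : \sum_(d < N) ((hilb m n)`_d - (hdim m n d)%:R) = 0.
  by apply/eqP; rewrite eq_le tot sumr_ge0.
apply/polyP => d; rewrite coef_hilbert_series -/(hdim m n d).
case: (ltnP d N) => [ltd|/small[-> ->] //].
have /eqP := psumr_eq0P pos tot0 (i := Ordinal ltd) isT.
by rewrite subr_eq0 => /eqP.
Qed.

End UpperBound.

(** * The sum over words *)

Section States.
Variables (K : fieldType) (t : K) (q m : nat).

Definition drop_term B : K := t ^+ (q ^ m - q ^ B).
Definition keep_term B : K :=
  (1 - t ^+ (q ^ m - q ^ B)) / (1 - t ^+ (q ^ B.+1 - q ^ B)).

(** The summand of the theorem for the word b, read as a product of local factors;
    B is the number of ones read so far. *)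
Fixpoint weight B (b : seq bool) : K :=
  match b with
  | [::] => 1
  | x :: b' => if x then keep_term B * weight B.+1 b' else drop_term B * weight B b'
  end.

(** A word with more than m ones passes through B = m on a letter one, where the
    numerator of [keep_term] is 1 - t^0. *)
Lemma weight_eq0 B b : (B <= m)%N -> (m < B + sumn (map nat_of_bool b))%N ->
  weight B b = 0.
Proof.
elim: b B => [|[] b IHb] B leBm /=; first by rewrite addn0 ltnNge leBm.
  have [->|neBm] := eqVneq B m; first by rewrite /keep_term subnn expr0 subrr !mul0r.
  by rewrite add1n addnS -addSn => /IHb -> ; rewrite ?mulr0 // ltn_neqAle neBm.
by rewrite add0n => /IHb ->; rewrite ?mulr0.
Qed.

Lemma weightE B b (beta := map nat_of_bool b) :
  weight B b =
  t ^+ (\sum_(0 <= i < size beta) (1 - nth 0%N beta i) * (q ^ m - q ^ (B + psum beta i.+1))) *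
  ((\prod_(B <= j < B + sumn beta) (1 - t ^+ (q ^ m - q ^ j))) /
   (\prod_(0 <= i < size beta) \prod_(1 <= j < (nth 0%N beta i).+1)
      (1 - t ^+ (q ^ (B + psum beta i.+1) - q ^ (B + psum beta i.+1 - j))))).
Proof.
rewrite /beta {beta}; elim: b B => [|x b IHb] B.
  by rewrite /= addn0 big_geq // !(big_geq (leqnn _)) expr0 mul1r divr1.
rewrite [map _ (_ :: _)]/= [size (_ :: _)]/= [sumn (_ :: _)]/=.
rewrite [in RHS]big_nat_recl // [\prod_(0 <= i < _.+1) _]big_nat_recl //.
have p1 y s : psum (y :: s) 1 = y by rewrite /psum /= take0 addn0.
have pS y s i : psum (y :: s) i.+2 = (y + psum s i.+1)%N by [].
rewrite p1 [nth _ _ 0]/=.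
under [in RHS]eq_bigr do rewrite pS [nth _ _ _]/=.
under [X in _ = _ * (_ / (_ * X))]eq_bigr do rewrite pS [nth _ _ _]/=.
case: x; rewrite [LHS]/= IHb.
  rewrite [nat_of_bool _]/= subnn mul0n add0n addn1 big_nat1 subn1 succnK.
  under [in RHS]eq_bigr do rewrite addnA addn1.
  under [X in _ = _ * (_ / (_ * X))]eq_bigr do rewrite addnA addn1.
  rewrite addnA addn1 [\prod_(B <= j < _) _]big_ltn ?addSn ?ltnS ?leq_addr //.
  by rewrite /keep_term invfM; ring.
rewrite [nat_of_bool _]/= subn0 mul1n add0n addn0 (big_geq (leqnn _)) mul1r exprD.
by rewrite -mulrA.
Qed.

End States.

(** The factors contributed by the last part m - |beta| cancel the factors with
    j >= |beta| of the numerator. *)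
Lemma qt_multinomialE q m b (beta := map nat_of_bool b) : (1 < q)%N -> (sumn beta <= m)%N ->
  qt_multinomial q (rcons beta (m - sumn beta)%N) =
  (\prod_(0 <= j < sumn beta) (1 - tvar ^+ (q ^ m - q ^ j))) /
  (\prod_(0 <= i < size beta) \prod_(1 <= j < (nth 0%N beta i).+1)
      (1 - tvar ^+ (q ^ psum beta i.+1 - q ^ (psum beta i.+1 - j)))).
Proof.
move=> q1 lekm; set k := sumn beta.
have sE : sumn (rcons beta (m - k)%N) = m by rewrite sumn_rcons subnKC.
have pl : psum (rcons beta (m - k)%N) (size beta).+1 = m.
  by rewrite /psum take_oversize ?size_rcons.
have pr i : (i < size beta)%N -> psum (rcons beta (m - k)%N) i.+1 = psum beta i.+1.
  by move=> lti; rewrite /psum -cats1 takel_cat.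
rewrite /qt_multinomial sE size_rcons big_nat_recr // pl nth_rcons ltnn eqxx.
rewrite [\prod_(0 <= j < m) _](big_cat_nat _ (n := k)) //=.
have -> : \prod_(1 <= j < (m - k).+1) (1 - tvar ^+ (q ^ m - q ^ (m - j))) =
          \prod_(k <= j < m) (1 - tvar ^+ (q ^ m - q ^ j)).
  rewrite [RHS]big_nat_rev /= -{2}[k]add0n big_addn big_add1.
  by apply: eq_bigr => j _; congr (1 - tvar ^+ (_ - q ^ _)); lia.
have nz : \prod_(k <= j < m) (1 - tvar ^+ (q ^ m - q ^ j)) != 0.
  rewrite big_nat prodf_seq_neq0; apply/allP => j _; apply/implyP => /andP[_ ltj].
  by apply: tvar_factor_neq0; rewrite subn_gt0 ltn_exp2l.
rewrite -mulf_div divff // mulr1; congr (_ / _).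
rewrite !big_nat; apply: eq_bigr => i /andP[_ lti].
by rewrite nth_rcons lti pr.
Qed.

Lemma sum_tuple_cons (K : nmodType) n (f : seq bool -> K) :
  \sum_(b : n.+1.-tuple bool) f b =
  \sum_(b : n.-tuple bool) f (true :: b) + \sum_(b : n.-tuple bool) f (false :: b).
Proof.
rewrite (reindex (fun p : bool * n.-tuple bool => [tuple of p.1 :: p.2])) /=; last first.
  exists (fun b : n.+1.-tuple bool => (thead b, [tuple of behead b])) => [[x b]|b] _ /=.
    by congr pair; apply: val_inj.
  by rewrite [RHS]tuple_eta; apply: val_inj.
rewrite -(pair_bigA _ (fun x (b : n.-tuple bool) => f (x :: b))) /=.
by rewrite big_bool.
Qed.

Section Hilb.
Variable F : finFieldType.
Local Notation q := #|F|.

(** After B ones the remaining sum has the shape of the original one, with m - B in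
    place of m and t^(q^B) in place of t. *)
Lemma sum_weight m B n : (B <= m)%N ->
  \sum_(b : n.-tuple bool) weight tvar q m B b =
  tofrac (hilb F (m - B) n \Po 'X^(q ^ B)).
Proof.
have q1 := card_finNzRing_gt1 F; have q0 := card_field_gt0 F.
elim: n B => [|n IHn] B leBm.
  rewrite (big_pred1 [tuple]) => [|b]; last exact/esym/eqP/tuple0.
  by rewrite /= comp_polyC tofrac1.
rewrite sum_tuple_cons /= -!mulr_sumr addrC (IHn B leBm).
rewrite comp_polyD !comp_polyM tofracD !tofracM; congr (_ + _).
  congr (_ * _); rewrite comp_Xn_poly -exprM tofracXn /drop_term; congr (_ ^+ _).
  by rewrite -subn1 mulnBr muln1 -expnD subnKC.
have [eBm|neBm] := eqVneq B m.
  rewrite eBm subnn /qint big_ord0 big_ord0 comp_poly0 tofrac0 mul0r.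
  by rewrite /keep_term subnn expr0 subrr !mul0r.
have ltBm : (B < m)%N by rewrite ltn_neqAle neBm.
rewrite IHn // -comp_polyA comp_Xn_poly -exprM -expnSr subnS.
congr (_ * _); rewrite /keep_term.
have e : (q ^ m - q ^ B = (q ^ B.+1 - q ^ B) * qint q (m - B))%N.
  rewrite -(subnKC leBm) expnD addnC addnK -{2}[(q ^ B)%N]muln1 -mulnBr subn1.
  rewrite -(qintE _ q0) expnSr -{3}[(q ^ B)%N]muln1 -mulnBr subn1.
  by rewrite -mulnA [(q.-1 * _)%N]mulnC.
rewrite e exprM -opprB subrX1 -mulNr opprB mulrAC divff ?mul1r; last first.
  by apply: tvar_factor_neq0; rewrite subn_gt0 ltn_exp2l.
rewrite raddf_sum rmorph_sum; apply: eq_bigr => i _ /=.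
rewrite comp_Xn_poly -!exprM tofracXn; congr (_ ^+ _).
by rewrite expnSr -{2}[(q ^ B)%N]muln1 -mulnBr subn1 -mulnA [(q.-1 * _)%N]mulnC.
Qed.

End Hilb.

Theorem corollary1p7 (F : finFieldType) (m n : nat) (n_gt0 : (0 < n)%N) :
  FracField.tofrac (hilbert_series F m n) =
  \sum_(b : n.-tuple bool | (sumn (map nat_of_bool b) <= m)%N)
     let beta := map nat_of_bool b in
     tvar ^+ e_exponent #|F| m beta *
     qt_multinomial #|F| (rcons beta (m - sumn beta)%N).
Proof.
have q1 := card_finNzRing_gt1 F.
have := sum_weight F n (leq0n m); rewrite subn0 expn0 expr1 comp_polyXr hilbert_seriesE => <-.
rewrite (bigID (fun b : n.-tuple bool => (sumn (map nat_of_bool b) <= m)%N)) /=.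
rewrite [X in _ + X]big1 ?addr0 => [|b]; last first.
  by rewrite -ltnNge => lt; rewrite (weight_eq0 _ _ (leq0n m) lt).
by apply: eq_bigr => b leb; rewrite qt_multinomialE // weightE.
Qed.
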